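(* Let $X$ be a smooth rank-1 Hermitian projector-valued function on an open set $\Omega\subset\mathbb{R}^2$. Then $X$ is holomorphic if and only if $\Pi_-X=0$.
   Context: Coordinates: $(\xi_1,\xi_2)\in\mathbb{R}^2$, $\xi_\pm=\xi_1\pm i\xi_2$, $\partial_\pm=\partial/\partial\xi_\pm=\frac12\left(\frac{\partial}{\partial \xi_1}\mp i\frac{\partial}{\partial\xi_2}\right)$. A rank-1 Hermitian projector (function) is an $N\times N$ complex matrix function $X(\xi_1,\xi_2)$ with $X^2=X$, $X^\dagger=X$, $\mathrm{tr}(X)=1$ pointwise. $X$ is called holomorphic if a nowhere zero vector field $x(\xi_+,\xi_-)$ onto which $X$ projects (so $X=xx^\dagger/(x^\dagger x)$) satisfies $\partial_-(c\,x)=0$ for some non-zero (nowhere vanishing) scalar function $c(\xi_+,\xi_-)$. Lowering operator: $$\Pi_-(X)=\frac{\partial_- X\,X\,\partial_+ X}{\mathrm{tr}(\partial_- X\,X\,\partial_+ X)}\ \text{ if } \partial_- X\,X\,\partial_+ X\neq 0,\qquad \Pi_-(X)=0\ \text{ if }\partial_- X\,X\,\partial_+ X= 0,$$ so $\Pi_-X=0$ means that $\partial_-X\,X\,\partial_+X$ vanishes identically. *)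

(* Defs.v *)
From mathcomp Require Import all_boot all_order all_algebra.
From mathcomp Require Import complex.
From mathcomp Require Import all_classical all_reals all_analysis.

Set Implicit Arguments.
Unset Strict Implicit.
Unset Printing Implicit Defensive.

Import Order.TTheory GRing.Theory Num.Theory.
Import numFieldNormedType.Exports.

Local Open Scope classical_set_scope.
Local Open Scope ring_scope.
Local Open Scope complex_scope.

Section Defs.
Variable R : realType.

Definition e1 : R * R := (1, 0).
Definition e2 : R * R := (0, 1).

Fixpoint Ck (k : nat) (Omega : set (R * R)) (f : R * R -> R) : Prop :=
  match k with
  | 0 => forall p, Omega p -> {for p, continuous f}
  | k'.+1 =>
      [/\ forall p, Omega p -> derivable f p e1 /\ derivable f p e2,
          Ck k' Omega ('D_e1 f)
        & Ck k' Omega ('D_e2 f)]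
  end.

Definition smooth_on (Omega : set (R * R)) (f : R * R -> R[i]) : Prop :=
  forall k, Ck k Omega (fun p => complex.Re (f p)) /\
            Ck k Omega (fun p => complex.Im (f p)).

Definition smooth_mx_on m n (Omega : set (R * R)) (F : R * R -> 'M[R[i]]_(m, n))
  : Prop := forall i j, smooth_on Omega (fun p => F p i j).

(* R[i] carries no normed R-module structure, so directional derivatives of a
   complex-valued function are taken on its real and imaginary parts. *)
Definition cderive (v : R * R) (f : R * R -> R[i]) (p : R * R) : R[i] :=
  'D_v (fun q => complex.Re (f q)) p +i* 'D_v (fun q => complex.Im (f q)) p.

Definition dplus (f : R * R -> R[i]) (p : R * R) : R[i] :=
  2%:R^-1 * (cderive e1 f p - (0 +i* 1) * cderive e2 f p).

Definition dminus (f : R * R -> R[i]) (p : R * R) : R[i] :=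
  2%:R^-1 * (cderive e1 f p + (0 +i* 1) * cderive e2 f p).

Definition dplus_mx m n (F : R * R -> 'M[R[i]]_(m, n)) (p : R * R)
  : 'M[R[i]]_(m, n) := \matrix_(i, j) dplus (fun q => F q i j) p.

Definition dminus_mx m n (F : R * R -> 'M[R[i]]_(m, n)) (p : R * R)
  : 'M[R[i]]_(m, n) := \matrix_(i, j) dminus (fun q => F q i j) p.

Definition adjmx m n (A : 'M[R[i]]_(m, n)) : 'M[R[i]]_(n, m) :=
  map_mx (fun z : R[i] => z^*) A^T.

Definition rank1_projector N (P : 'M[R[i]]_N) : Prop :=
  [/\ P *m P = P, adjmx P = P & \tr P = 1].

Definition projects_onto N (P : 'M[R[i]]_N) (x : 'cV[R[i]]_N) : Prop :=
  P = ((adjmx x *m x) 0 0)^-1 *: (x *m adjmx x).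

(* Both the vector field and the rescaling factor are defined on all of Omega,
   not only near each point; they are required to be smooth because dminus is
   meaningless at points of non-differentiability. *)
Definition holomorphic N (Omega : set (R * R)) (X : R * R -> 'M[R[i]]_N)
  : Prop :=
  exists (x : R * R -> 'cV[R[i]]_N) (c : R * R -> R[i]),
    [/\ smooth_mx_on Omega x,
        smooth_on Omega c,
        forall p, Omega p -> x p != 0 /\ projects_onto (X p) (x p),
        forall p, Omega p -> c p != 0
      & forall p, Omega p -> dminus_mx (fun q => c q *: x q) p = 0].

Definition Pi_minus N (X : R * R -> 'M[R[i]]_N) (p : R * R) : 'M[R[i]]_N :=
  let A := dminus_mx X p *m X p *m dplus_mx X p in
  if A == 0 then 0 else (\tr A)^-1 *: A.

End Defs.

(* Main.v *)
Require Import Defs.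
From mathcomp Require Import all_boot all_order all_algebra.
From mathcomp Require Import finmap complex.
From mathcomp Require Import all_classical all_reals all_analysis.
From mathcomp Require Import ring lra.
Set Implicit Arguments.
Unset Strict Implicit.
Unset Printing Implicit Defensive.
Import Order.TTheory GRing.Theory Num.Theory.
Import numFieldNormedType.Exports.
Local Open Scope classical_set_scope.
Local Open Scope ring_scope.
Local Open Scope complex_scope.

Notation Cx R := (R[i] : numFieldType).

(** Put B = (d_- X) X. Since X is Hermitian, the matrix (d_- X) X (d_+ X) is
    B times its adjoint, so the lowering operator annihilates X if and only if
    B = 0 ([Pi_minus_eq0]).

    If X projects onto a field y with d_- y = 0, then differentiating X y = y
    gives (d_- X) y = 0, hence B = 0.

    Conversely let B = 0. Differentiating X X = X gives d_- X = X (d_- X), so the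
    columns of d_- X lie in the line spanned by X. It follows that the section
    X e_j / X_jj of this line bundle is holomorphic where X_jj is nonzero
    ([section_holo]). It is defined locally near every point for a suitable j,
    and a nowhere zero holomorphic section on all of Omega is still needed; in
    other words, a holomorphic line bundle over a plane domain has to be
    trivialized. For an index j such that X_jj is not identically zero on any
    open set, X e_j / X_jj is a meromorphic section: near each point some other
    normalized section is holomorphic, and its j-th coordinate is a power of
    the coordinate times a function without zeros ([holo_factor],
    [exists_local_section]). Its poles are discrete, and Weierstrass's theorem
    ([weierstrass]) gives a holomorphic function whose zeros cancel them. The
    index j may have to change from one connected component to another, which
    is why the least possible index at each point is used ([leading]).

    The complex analysis behind this rests on Cauchy's formula on circles
    ([cauchy]). It writes a holomorphic function as the Cauchy transform of a
    density on a circle, and this representation yields smoothness, stability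
    under uniform limits and the factorization at a zero. Weierstrass's
    theorem is proved for an arbitrary open set: the zeros are sorted by a
    compact exhaustion, and each zero outside one of the compact sets is
    produced by a factor that is close to 1 on that set ([near1_factor]). *)

(** * The topology of the complex plane *)

Section ComplexTopology.
Variable R : realType.
Local Notation C := (Cx R).
Local Notation N := (@Normc.normc R).
Implicit Types (z w c : C) (r : R).

Lemma normCE z : `|z| = (N z)%:C. Proof. by []. Qed.

Lemma nc_ge0 z : 0 <= N z.
Proof. by rewrite -lecR -normCE normr_ge0. Qed.

Lemma nc_eq0 z : (N z == 0) = (z == 0).
Proof. by rewrite -(inj_eq (@complexI R)) -normCE normr_eq0. Qed.

Lemma nc_gt0 z : (0 < N z) = (z != 0).
Proof. by rewrite lt_neqAle nc_ge0 andbT eq_sym nc_eq0. Qed.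

Lemma nc0 : N (0 : C) = 0. Proof. exact: Normc.normc0. Qed.

Lemma nc1 : N (1 : C) = 1. Proof. exact: Normc.normc1. Qed.

Lemma ncM z w : N (z * w) = N z * N w.
Proof. exact: Normc.normcM. Qed.

Lemma ncV z : N z^-1 = (N z)^-1.
Proof. exact: Normc.normcV. Qed.

Lemma ncX z n : N (z ^+ n) = N z ^+ n.
Proof. by elim: n => [|n IH]; rewrite ?expr0 ?nc1 // !exprS ncM IH. Qed.

Lemma ncN z : N (- z) = N z.
Proof. exact: normcN. Qed.

Lemma ncD z w : N (z + w) <= N z + N w.
Proof. exact: le_normcD. Qed.

Lemma ncBC z w : N (z - w) = N (w - z).
Proof. by rewrite -ncN opprB. Qed.

Lemma ncB z w : N (z - w) <= N z + N w.
Proof. by rewrite -(ncN w) ncD. Qed.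

Lemma ncB_ge z w : N z - N w <= N (z - w).
Proof. by rewrite lerBlDr; apply: le_trans (ncD _ _); rewrite subrK. Qed.

Lemma ncR (x : R) : N (x%:C : C) = `|x|.
Proof. by rewrite /= expr0n /= addr0 sqrtr_sqr. Qed.

Lemma nc_Re z : `|complex.Re z| <= N z.
Proof.
by case: z => a b /=; rewrite -sqrtr_sqr ler_wsqrtr // lerDl sqr_ge0.
Qed.

Lemma nc_Im z : `|complex.Im z| <= N z.
Proof.
by case: z => a b /=; rewrite -sqrtr_sqr ler_wsqrtr // lerDr sqr_ge0.
Qed.

Lemma nc_le_ReIm z : N z <= `|complex.Re z| + `|complex.Im z|.
Proof.
have -> : z = (complex.Re z)%:C + 'i%C * (complex.Im z)%:C by exact: complexE.
apply: le_trans (ncD _ _) _; rewrite ncM !ncR.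
have -> : N ('i%C : C) = 1 by rewrite /= expr0n /= expr1n add0r sqrtr1.
by case: z => a b /=; rewrite !(mulr0, mul0r, mul1r, addr0, subr0, add0r).
Qed.

Lemma nc_sum I (s : seq I) (P : pred I) (F : I -> C) :
  N (\sum_(i <- s | P i) F i) <= \sum_(i <- s | P i) N (F i).
Proof.
elim/big_rec2: _ => [|i y x _ le_xy]; first by rewrite nc0.
by apply: le_trans (ncD _ _) _; rewrite lerD2l.
Qed.

Lemma nbhsC z (A : set C) :
  nbhs z A <-> exists2 r : R, 0 < r & forall w, N (w - z) < r -> A w.
Proof.
split=> [/nbhs_ballP[e /= e0 zA]|[r r0 zA]].
  have eE : e = (complex.Re e)%:C.
    by case: e e0 {zA} => a b; rewrite ltcE /= => /andP[/eqP -> _].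
  exists (complex.Re e); first by move: e0; rewrite ltcE => /andP[_].
  move=> w wz; apply: zA; rewrite /ball /= eE.
  by rewrite normCE ltcR ncBC.
apply/nbhs_ballP; exists r%:C => /=; first by rewrite ltcR.
by move=> w; rewrite /ball /= normCE ltcR => wz; apply: zA; rewrite ncBC.
Qed.

(** Lets filter reasoning apply to neighbourhoods of complex numbers without
    unfolding the topology. *)
Global Instance nbhsC_filter z : ProperFilter (nbhs z).
Proof. exact: nbhs_pfilter. Qed.

Lemma near_disc z r : 0 < r -> \forall w \near z, N (w - z) < r.
Proof. by move=> r0; apply/nbhsC; exists r. Qed.

Definition disc c r : set C := [set w | N (w - c) < r].

Lemma disc_center c r : 0 < r -> disc c r c.
Proof. by rewrite /disc /= subrr nc0. Qed.

Lemma disc_nbhs c r z : disc c r z -> nbhs z (disc c r).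
Proof.
move=> zr; apply/nbhsC; exists (r - N (z - c)); first by rewrite subr_gt0.
move=> w wz; rewrite /disc /=.
have -> : w - c = (w - z) + (z - c) by ring.
by apply: le_lt_trans (ncD _ _) _; rewrite -ltrBrDr.
Qed.

Lemma cvgC_ReIm (T : Type) (F : set_system T) (FF : Filter F) (f : T -> C) (l : C) :
  complex.Re (f t) @[t --> F] --> complex.Re l ->
  complex.Im (f t) @[t --> F] --> complex.Im l -> f @ F --> l.
Proof.
move=> fr fi A /nbhsC[r r0 rA].
have r2 : 0 < r / 2 by rewrite divr_gt0.
move/cvgrPdist_lt: fr => /(_ _ r2) fr; move/cvgrPdist_lt: fi => /(_ _ r2) fi.
apply: filterS2 fi fr => t ti tr; apply: rA.
apply: le_lt_trans (nc_le_ReIm _) _.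
rewrite [ltRHS]splitr; apply: ltrD.
  by rewrite distrC in tr; move: tr {ti}; case: (f t) l => a b [].
by rewrite distrC in ti; move: ti {tr}; case: (f t) l => a b [].
Qed.

Lemma lipschitzC_continuous (f : C -> R) :
  (forall z w, `|f w - f z| <= N (w - z)) -> continuous f.
Proof.
move=> lf z A /nbhs_ballP[e /= e0 eA]; apply/nbhsC; exists e => // w wz.
by apply: eA; rewrite /ball /= distrC; exact: le_lt_trans wz.
Qed.

Lemma continuousRe : continuous (fun z => complex.Re z).
Proof.
apply: lipschitzC_continuous => z w; have := nc_Re (w - z).
by move: w z => [a b] [c d].
Qed.

Lemma continuousIm : continuous (fun z => complex.Im z).
Proof.
apply: lipschitzC_continuous => z w; have := nc_Im (w - z).
by move: w z => [a b] [c d].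
Qed.

Lemma continuous_ncB c : continuous (fun z => N (z - c)).
Proof.
apply: lipschitzC_continuous => z w.
have := ncB_ge (z - c) (w - c); have := ncB_ge (w - c) (z - c).
rewrite (_ : w - c - (z - c) = w - z); last by ring.
rewrite (_ : z - c - (w - c) = z - w); last by ring.
by rewrite ler_norml (ncBC z w); lra.
Qed.

Lemma continuous_nc : continuous (fun z => N z).
Proof. by move=> z; move: (@continuous_ncB 0 z); under eq_fun do rewrite subr0. Qed.

Lemma continuous_realC : continuous (fun x : R => x%:C : C).
Proof.
by move=> x; apply: cvgC_ReIm => /=; [exact: cvg_id | exact: cvg_cst].
Qed.

Definition toC (p : R * R) : C := p.1 +i* p.2.
Definition ofC (z : C) : R * R := (complex.Re z, complex.Im z).

Lemma toCK p : ofC (toC p) = p. Proof. by case: p. Qed.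
Lemma ofCK z : toC (ofC z) = z. Proof. by case: z. Qed.

Lemma continuous_toC : continuous toC.
Proof.
by move=> p; apply: cvgC_ReIm => /=; [exact: cvg_fst | exact: cvg_snd].
Qed.

Lemma continuous_ofC : continuous ofC.
Proof.
move=> z A [[B1 B2] /= [h1 h2] sB].
have {}h1 : nbhs z ((fun w : C => complex.Re w) @^-1` B1) := continuousRe h1.
have {}h2 : nbhs z ((fun w : C => complex.Im w) @^-1` B2) := continuousIm h2.
by apply: filterS2 h1 h2 => w w1 w2; exact: (sB (_, _)).
Qed.

(** A closed disc is a closed subset of the image of a compact square. *)
Lemma compact_cdisc c r : compact [set z | N (z - c) <= r].
Proof.
move: c => [x y].
pose S := `[x - r, x + r]%classic `*`
          `[y - r, y + r]%classic : set (R * R).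
have cS : compact S by apply: compact_setX; exact: segment_compact.
have cT : compact (toC @` S).
  apply: continuous_compact => //; apply: continuous_subspaceT.
  exact: continuous_toC.
apply: (subclosed_compact _ cT) => [|z zr]; last first.
  exists (ofC z); last exact: ofCK.
  have := le_trans (nc_Re _) zr; have := le_trans (nc_Im _) zr.
  case: z {zr} => a b /=.
  rewrite !ler_norml => /andP[h1 h2] /andP[h3 h4].
  by rewrite /S; split; rewrite /= in_itv /=; apply/andP; split; lra.
pose c : C := x +i* y.
rewrite -[X in closed X]/((fun z => N (z - c)) @^-1` [set x | x <= r]).
apply: closed_comp; last exact: closed_le.
by move=> z _; exact: continuous_ncB.
Qed.

Lemma cdisc_bounded (f : C -> C) c r :
  (forall z, N (z - c) <= r -> {for z, continuous f}) ->
  exists M, forall z, N (z - c) <= r -> N (f z) <= M.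
Proof.
move=> cf.
have cI : compact ((fun z => N (f z)) @` [set z | N (z - c) <= r]).
  apply: continuous_compact; last exact: compact_cdisc.
  apply: continuous_in_subspaceT => z /set_mem zr.
  by apply: continuous_comp; [exact: cf | exact: continuous_nc].
have [M [_ MP]] := compact_bounded cI.
exists (M + 1) => z zr; apply: le_trans (ler_norm _) _.
by apply: (MP (M + 1)); [rewrite ltrDl | exists z].
Qed.

End ComplexTopology.

(** * Complex derivatives *)

Section ComplexDerivative.
Variable R : realType.
Local Notation C := (Cx R).
Local Notation N := (@Normc.normc R).
Implicit Types (z w c l : C) (f g : C -> C).

(** Continuity at a point, wrapped so that unification does not look through
    it and into the field operations of the complex numbers. *)
Variant ccont f z : Prop := CCont of {for z, continuous f}.

(** Caratheodory's form of differentiability: the difference quotient at z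
    extends to a function that is continuous at z. The rules for products,
    inverses and compositions become algebraic identities. *)
Definition cder f z l :=
  exists q : C -> C, [/\ q z = l, ccont q z
    & \forall w \near z, f w = f z + q w * (w - z)].

Lemma ccontP f z : ccont f z ->
  forall A : set C, nbhs (f z) A -> nbhs z (f @^-1` A).
Proof. by case. Qed.

Lemma cont_cst (a z : C) : ccont (fun _ : C => a) z.
Proof. by split; exact: cvg_cst. Qed.

Lemma cont_id z : ccont (fun w : C => w) z.
Proof. by split; exact: cvg_id. Qed.

Lemma contD f g z : ccont f z -> ccont g z ->
  ccont (fun w => f w + g w) z.
Proof. move=> [cf] [cg]; split; exact (continuousD cf cg). Qed.

Lemma contB f g z : ccont f z -> ccont g z ->
  ccont (fun w => f w - g w) z.
Proof. move=> [cf] [cg]; split; exact (continuousB cf cg). Qed.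

Lemma contM f g z : ccont f z -> ccont g z ->
  ccont (fun w => f w * g w) z.
Proof. move=> [cf] [cg]; split; exact (continuousM cf cg). Qed.

Lemma contV f z : f z != 0 -> ccont f z ->
  ccont (fun w => (f w)^-1) z.
Proof. by move=> fz [cf]; split; exact: continuousV. Qed.

Lemma cont_comp f g z : ccont f z -> ccont g (f z) ->
  ccont (fun w => g (f w)) z.
Proof. by move=> cf [cg]; split=> A /cg /(ccontP cf). Qed.

Lemma cont_near f g z : ccont f z ->
  (\forall w \near z, f w = g w) -> ccont g z.
Proof.
move=> [cf] fg; split=> A; rewrite -(nbhs_singleton fg) => /cf fA.
by apply: filterS2 fg fA => w /= ->.
Qed.

Lemma cont_neq0 f z : ccont f z -> f z != 0 ->
  \forall w \near z, f w != 0.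
Proof.
move=> cf fz; have fz0 : 0 < N (f z) by rewrite nc_gt0.
apply: filterS (ccontP cf (near_disc _ fz0)) => w.
by apply: contraTneq => ->; rewrite sub0r ncN ltxx.
Qed.

Lemma cder_continuous f z l : cder f z l -> ccont f z.
Proof.
move=> [q [_ cq fq]]; apply: cont_near (filterS _ fq); last first.
  by move=> w /= e; apply/esym; exact: e.
apply: contD; first exact: cont_cst.
by apply: contM cq _; apply: contB; [exact: cont_id | exact: cont_cst].
Qed.

Lemma cder_near f g z l : cder f z l -> (\forall w \near z, f w = g w) ->
  cder g z l.
Proof.
move=> [q [ql cq fq]] fg; exists q; split; [exact: ql|exact: cq|].
by rewrite -(nbhs_singleton fg); apply: filterS2 fq fg => w /= <- ->.
Qed.

Lemma cder_cst (a z : C) : cder (fun=> a) z 0.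
Proof.
exists (fun=> 0); split; [by []| |]; first exact: cont_cst.
by near=> w; rewrite mul0r addr0.
Unshelve. all: by end_near. Qed.

Lemma cder_id z : cder (fun w => w) z 1.
Proof.
exists (fun=> 1); split; [by []| |]; first exact: cont_cst.
by near=> w; rewrite mul1r addrC subrK.
Unshelve. all: by end_near. Qed.

Lemma cderD f g z a b : cder f z a -> cder g z b ->
  cder (fun w => f w + g w) z (a + b).
Proof.
move=> [q [<- cq fq]] [p [<- cp gp]]; exists (fun w => q w + p w).
split; [by []|exact: contD|].
by apply: filterS2 fq gp => w -> ->; ring.
Qed.

Lemma cderM f g z a b : cder f z a -> cder g z b ->
  cder (fun w => f w * g w) z (a * g z + f z * b).
Proof.
move=> df dg; have cg := cder_continuous dg.
move: df dg => [q [<- cq fq]] [p [<- cp gp]].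
exists (fun w => q w * g w + f z * p w); split; [by []| |].
  by apply: contD; apply: contM => //; exact: cont_cst.
by apply: filterS2 fq gp => w -> ->; ring.
Qed.

Lemma cderZ (k : C) f z a : cder f z a -> cder (fun w => k * f w) z (k * a).
Proof.
by move=> /(cderM (cder_cst k z)); rewrite mul0r add0r.
Qed.

Lemma cderN f z a : cder f z a -> cder (fun w => - f w) z (- a).
Proof.
move=> /(cderZ (-1)); rewrite mulN1r => /cder_near; apply.
by near=> w; rewrite mulN1r.
Unshelve. all: by end_near. Qed.

Lemma cderB f g z a b : cder f z a -> cder g z b ->
  cder (fun w => f w - g w) z (a - b).
Proof. by move=> df /cderN; exact: cderD. Qed.

Lemma cderV f z a : f z != 0 -> cder f z a ->
  cder (fun w => (f w)^-1) z (- a / f z ^+ 2).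
Proof.
move=> fz0 df; have cf := cder_continuous df.
have nf := cont_neq0 cf fz0.
move: df => [q [<- cq fq]].
exists (fun w => - q w / (f w * f z)); split; [by rewrite -expr2| |].
  apply: contM; last first.
    apply: contV; first by rewrite mulf_neq0.
    by apply: contM => //; exact: cont_cst.
  apply: cont_near (contM (cont_cst (-1) z) cq) _.
  by near=> w; rewrite mulN1r.
apply: filterS2 fq nf => w e nfw.
have {}e : q w * (w - z) = f w - f z by rewrite e [f z + _]addrC addrK.
by rewrite mulrAC mulNr e; field; rewrite nfw fz0.
Unshelve. all: by end_near. Qed.

Lemma cder_comp f g z a b : cder f z a -> cder g (f z) b ->
  cder (fun w => g (f w)) z (b * a).
Proof.
move=> df dg; have cf := cder_continuous df.
move: df dg => [q [<- cq fq]] [p [<- cp gp]].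
exists (fun w => p (f w) * q w); split; [by []| |].
  by apply: contM => //; exact: cont_comp cf cp.
have {}gp := ccontP cf gp.
apply: filterS2 fq gp => w e ->; rewrite e; ring.
Qed.

(** Two difference quotients agree off z, hence at z by continuity. *)
Lemma cder_unique f z a b : cder f z a -> cder f z b -> a = b.
Proof.
move=> [q [<- cq fq]] [p [<- cp fp]]; apply/eqP; rewrite -subr_eq0.
case: (boolP (_ == 0)) => // qp.
have /nbhsC[r r0] : nbhs z [set w | q w - p w != 0 /\ (q w - p w) * (w - z) = 0].
  apply: filterS3 fq fp (cont_neq0 (contB cq cp) qp) => w e1 e2 e3.
  split => //; apply: (addrI (f z)); rewrite addr0 mulrBl addrA -e1 e2.
  by rewrite addrK.
move=> /(_ (z + (r / 2)%:C)) [].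
  by rewrite [z + _]addrC addrK ncR ger0_norm; lra.
rewrite [z + _]addrC addrK => n0 /eqP; rewrite mulf_eq0 (negbTE n0) /=.
by rewrite -nc_eq0 ncR normr_eq0 mulf_eq0 invr_eq0 !gt_eqF.
Qed.

(** Continuity of the derivative is part of the definition: it makes the
    integrands of Cauchy's formula continuous, and the existence of all further
    derivatives is a consequence of that formula. *)
Definition holo_at f z := exists f' : C -> C,
  (\forall w \near z, cder f w (f' w)) /\ ccont (f') z.

Lemma holo_cder f z : holo_at f z -> exists l, cder f z l.
Proof. by move=> [f' [/nbhs_singleton df _]]; exists (f' z). Qed.

Lemma holo_cont f z : holo_at f z -> ccont f z.
Proof. by move=> /holo_cder[l /cder_continuous]. Qed.

Lemma holo_near f g z : holo_at f z -> (\forall w \near z, f w = g w) ->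
  holo_at g z.
Proof.
move=> [f' [df cf']] fg; exists f'; split => //.
by apply: filterS2 df (near_join fg) => w dfw; exact: cder_near dfw.
Qed.

Lemma holo_cst (a z : C) : holo_at (fun=> a) z.
Proof.
exists (fun=> 0); split; last exact: cont_cst.
by near=> w; exact: cder_cst.
Unshelve. all: by end_near. Qed.

Lemma holo_id z : holo_at (fun w => w) z.
Proof.
exists (fun=> 1); split; last exact: cont_cst.
by near=> w; exact: cder_id.
Unshelve. all: by end_near. Qed.

Lemma holoD f g z : holo_at f z -> holo_at g z ->
  holo_at (fun w => f w + g w) z.
Proof.
move=> [f' [df cf]] [g' [dg cg]]; exists (fun w => f' w + g' w).
split; last exact: contD.
by apply: filterS2 df dg => w; exact: cderD.
Qed.

Lemma holoM f g z : holo_at f z -> holo_at g z ->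
  holo_at (fun w => f w * g w) z.
Proof.
move=> hf hg; have cf := holo_cont hf; have cg := holo_cont hg.
move: hf hg => [f' [df cf']] [g' [dg cg']].
exists (fun w => f' w * g w + f w * g' w); split.
  by apply: filterS2 df dg => w; exact: cderM.
by apply: contD; exact: contM.
Qed.

Lemma holoB f g z : holo_at f z -> holo_at g z ->
  holo_at (fun w => f w - g w) z.
Proof.
move=> hf hg; apply: holo_near (holoD hf (holoM (holo_cst (-1) z) hg)) _.
by near=> w; rewrite mulN1r.
Unshelve. all: by end_near. Qed.

Lemma holoV f z : f z != 0 -> holo_at f z -> holo_at (fun w => (f w)^-1) z.
Proof.
move=> fz0 hf; have cf := holo_cont hf; have nf := cont_neq0 cf fz0.
move: hf => [f' [df cf']].
exists (fun w => (-1) * f' w * (f w * f w)^-1); split.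
  by apply: filterS2 df nf => w dw nw; rewrite mulN1r -expr2; exact: cderV.
apply: contM; first by apply: contM => //; exact: cont_cst.
by apply: contV; [rewrite mulf_neq0 | exact: contM].
Qed.

Lemma holo_comp f g z : holo_at f z -> holo_at g (f z) ->
  holo_at (fun w => g (f w)) z.
Proof.
move=> hf hg; have cf := holo_cont hf.
move: hf hg => [f' [df cf']] [g' [dg cg']].
exists (fun w => g' (f w) * f' w); split.
  have {}dg := ccontP cf dg.
  by apply: filterS2 df dg => w; exact: cder_comp.
by apply: contM => //; exact: cont_comp cf cg'.
Qed.

Lemma holoX f z n : holo_at f z -> holo_at (fun w => f w ^+ n) z.
Proof.
move=> hf; elim: n => [|n IH].
  by under eq_fun do rewrite expr0; exact: holo_cst.
by under eq_fun do rewrite exprS; exact: holoM.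
Qed.

Lemma holo_sum (I : Type) (s : seq I) (F : I -> C -> C) z :
  (forall i, holo_at (F i) z) -> holo_at (fun w => \sum_(i <- s) F i w) z.
Proof.
move=> hF; elim: s => [|i s IH].
  by under eq_fun do rewrite big_nil; exact: holo_cst.
by under eq_fun do rewrite big_cons; exact: holoD.
Qed.

End ComplexDerivative.

(** * Directional derivatives of complex-valued functions *)

Section DirectionalDerivative.
Variables (R : realType) (V : normedModType R).
Local Notation C := (Cx R).
Local Notation N := (@Normc.normc R).
Implicit Types (p v : V) (g : V -> C) (d l : C).

(** Taken componentwise, like the operator cderive. *)
Definition vder g p v d :=
  is_derive p v (fun q => complex.Re (g q)) (complex.Re d) /\
  is_derive p v (fun q => complex.Im (g q)) (complex.Im d).

Definition vquot g p v (h : R) : C := h^-1%:C * (g (h *: v + p) - g p).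

Lemma Re_vquot g p v h : complex.Re (vquot g p v h) =
  h^-1 *: (complex.Re (g (h *: v + p)) - complex.Re (g p)).
Proof.
rewrite /vquot; case: (g _) (g p) => a b [x y] /=.
by rewrite mul0r subr0.
Qed.

Lemma Im_vquot g p v h : complex.Im (vquot g p v h) =
  h^-1 *: (complex.Im (g (h *: v + p)) - complex.Im (g p)).
Proof.
rewrite /vquot; case: (g _) (g p) => a b [x y] /=.
by rewrite mul0r addr0.
Qed.

(** The limit form of vder, in which the rules of calculus are rules for limits
    of complex numbers. *)
Lemma vderP g p v d : vder g p v d <-> vquot g p v @ 0^' --> d.
Proof.
split=> [[dr di]|dg].
  apply: cvgC_ReIm.
    under eq_fun do rewrite Re_vquot.
    case: dr => dr <-; exact: dr.
  under eq_fun do rewrite Im_vquot.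
  case: di => di <-; exact: di.
have dr : (fun h => complex.Re (vquot g p v h)) @ 0^' --> complex.Re d.
  by move=> A /continuousRe /dg.
have di : (fun h => complex.Im (vquot g p v h)) @ 0^' --> complex.Im d.
  by move=> A /continuousIm /dg.
rewrite (eq_fun (Re_vquot g p v)) in dr.
rewrite (eq_fun (Im_vquot g p v)) in di.
split; split; [|exact: cvg_lim dr| |exact: cvg_lim di].
- by apply/cvg_ex; exists (complex.Re d).
- by apply/cvg_ex; exists (complex.Im d).
Qed.

Lemma cvgCM (F : set_system R) {FF : Filter F} (a b : R -> C) (x y : C) :
  a @ F --> x -> b @ F --> y -> (fun h => a h * b h) @ F --> x * y.
Proof. move=> ax bY; exact (cvgM ax bY). Qed.

Lemma cvgCD (F : set_system R) {FF : Filter F} (a b : R -> C) (x y : C) :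
  a @ F --> x -> b @ F --> y -> (fun h => a h + b h) @ F --> x + y.
Proof. move=> ax bY; exact (cvgD ax bY). Qed.

Lemma cvgC_near (F : set_system R) {FF : Filter F} (a b : R -> C) (x : C) :
  a @ F --> x -> (\forall h \near F, a h = b h) -> b @ F --> x.
Proof. by move=> ax ab A /ax aA; apply: filterS2 ab aA => h /= ->. Qed.

Lemma vder_cvg g p v d : vder g p v d ->
  (fun h : R => g (h *: v + p)) @ 0^' --> g p.
Proof.
move=> /vderP dg.
have c0 : (fun h : R => h%:C : C) @ 0^' --> (0 : C).
  apply: (cvg_trans _ (@continuous_realC R 0)).
  by apply: cvg_app; exact: cvg_within.
pose proof (cvgCD (cvg_cst (g p)) (cvgCM c0 dg)) as H.
rewrite mul0r addr0 in H; apply: (cvgC_near H).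
near=> h.
rewrite /vquot mulrA -rmorphM /= divff ?rmorph1; last by near: h; exact: nbhs_dnbhs_neq.
by rewrite mul1r addrC subrK.
Unshelve. all: by end_near. Qed.

Lemma vder_comp g p v d (f : C -> C) l : vder g p v d -> cder f (g p) l ->
  vder (fun q => f (g q)) p v (l * d).
Proof.
move=> dg [q [<- cq fq]]; apply/vderP.
have gc := vder_cvg dg; move/vderP : dg => dg.
have qc : (fun h : R => q (g (h *: v + p))) @ 0^' --> q (g p).
  by move=> A /(ccontP cq) /gc.
apply: (cvgC_near (cvgCM qc dg)).
have {}fq : nbhs 0^' ((fun h : R => g (h *: v + p)) @^-1`
    [set w | f w = f (g p) + q w * (w - g p)]) := gc _ fq.
apply: filterS fq => h e.
rewrite /= in e.
by rewrite /vquot e [f (g p) + _]addrC addrK mulrCA.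
Qed.

Lemma vderD g1 g2 p v d1 d2 : vder g1 p v d1 -> vder g2 p v d2 ->
  vder (fun q => g1 q + g2 q) p v (d1 + d2).
Proof.
move=> /vderP h1 /vderP h2; apply/vderP.
apply: (cvgC_near (cvgCD h1 h2)).
by near=> h; rewrite /vquot /=; ring.
Unshelve. all: by end_near. Qed.

Lemma vderM g1 g2 p v d1 d2 : vder g1 p v d1 -> vder g2 p v d2 ->
  vder (fun q => g1 q * g2 q) p v (d1 * g2 p + g1 p * d2).
Proof.
move=> h1 h2; have c2 := vder_cvg h2.
move/vderP: h1 => h1; move/vderP: h2 => h2; apply/vderP.
pose proof (cvgCD (cvgCM h1 c2) (cvgCM (cvg_cst (g1 p)) h2)) as H.
apply: (cvgC_near H).
by near=> h; rewrite /vquot /=; ring.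
Unshelve. all: by end_near. Qed.

Lemma vder_cst (a : C) p v : vder (fun=> a) p v 0.
Proof.
apply/vderP; pose proof (cvg_cst (0 : C) : (fun _ : R => 0 : C) @ 0^' --> (0 : C)) as H.
apply: (cvgC_near H).
by near=> h; rewrite /vquot subrr mulr0.
Unshelve. all: by end_near. Qed.

Lemma vder_near g1 g2 p v d : vder g1 p v d ->
  (\forall q \near p, g1 q = g2 q) -> vder g2 p v d.
Proof.
move=> [dr di] e; split.
- by apply: near_eq_is_derive dr; apply: filterS e => q ->.
- by apply: near_eq_is_derive di; apply: filterS e => q ->.
Qed.

End DirectionalDerivative.

(** * Integration over the unit circle *)

Section CircleIntegral.
Variable R : realType.
Local Notation C := (Cx R).
Local Notation N := (@Normc.normc R).
Implicit Types (z w c l u : C) (f g G phi psi : C -> C).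

Definition cis (t : R) : C := cos t +i* sin t.

Lemma nc_cis t : N (cis t) = 1.
Proof. by rewrite /= cos2Dsin2 sqrtr1. Qed.

Lemma cis_2pi : cis (pi *+ 2) = cis 0.
Proof. by rewrite /cis cos2pi sin2pi cos0 sin0. Qed.

Lemma vder_cis t : vder cis t (1 : R) ('i%C * cis t).
Proof.
have -> : 'i%C * cis t = - sin t +i* cos t.
  by apply/eqP; rewrite eq_complex /= !(mul0r, mul1r) sub0r add0r !eqxx.
by split; [exact: is_derive_cos|exact: is_derive_sin].
Qed.

Lemma continuous_cis : continuous cis.
Proof.
move=> t; apply: cvgC_ReIm => /=; [exact: continuous_cos|exact: continuous_sin].
Qed.

Definition ucont phi := forall u, N u = 1 -> ccont phi u.

Local Notation mu := (@lebesgue_measure R).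
Local Notation J := (`[(0 : R), pi *+ 2]%classic).

Let Jlt : (0 : R) < pi *+ 2. Proof. by rewrite pmulrn_lgt0 // pi_gt0. Qed.

Lemma ucont_cis phi : ucont phi -> continuous (fun t => phi (cis t)).
Proof.
move=> cphi t A phiA.
exact: (continuous_cis (ccontP (cphi _ (nc_cis t)) phiA)).
Qed.

Lemma ucont_Re phi : ucont phi ->
  continuous (fun t => complex.Re (phi (cis t))).
Proof. by move=> cphi t A /continuousRe /(ucont_cis cphi). Qed.

Lemma ucont_Im phi : ucont phi ->
  continuous (fun t => complex.Im (phi (cis t))).
Proof. by move=> cphi t A /continuousIm /(ucont_cis cphi). Qed.

Lemma integrable_J (h : R -> R) : continuous h ->
  mu.-integrable J (EFin \o h).
Proof.
move=> ch; apply: continuous_compact_integrable; first exact: segment_compact.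
exact: continuous_subspaceT.
Qed.

Lemma measurable_J : measurable J. Proof. exact: measurable_itv. Qed.
Local Hint Resolve measurable_J : core.

Definition rint (h : R -> R) : R := Rintegral mu J h.

Lemma rint_bound h M : continuous h -> (forall t, `|h t| <= M) ->
  `|rint h| <= M * (pi *+ 2).
Proof.
move=> ch hM; have ih := integrable_J ch.
apply: le_trans (le_normr_Rintegral _ ih) _ => //.
have ia : mu.-integrable J (EFin \o (fun t => `|h t|)).
  by apply: integrable_J => t; apply: continuous_comp; [exact: ch|exact: norm_continuous].
have ic : mu.-integrable J (EFin \o (fun=> M)).
  by apply: integrable_J => t; exact: cvg_cst.
apply: le_trans (le_Rintegral _ ia ic _) _ => //.
rewrite Rintegral_cst // /= lebesgue_measure_itv /= lte_fin Jlt.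
by rewrite -EFinD /= subr0.
Qed.

Lemma rint_cst (k : R) : rint (fun=> k) = k * (pi *+ 2).
Proof.
rewrite /rint Rintegral_cst // /= lebesgue_measure_itv /= lte_fin Jlt.
by rewrite -EFinD /= subr0.
Qed.

Lemma rint_exact (H h : R -> R) : (forall t, is_derive t (1 : R) H (h t)) ->
  continuous h -> rint h = H (pi *+ 2) - H 0.
Proof.
move=> dH ch; rewrite /rint /Rintegral.
have cH t : {for t, continuous H}.
  by apply: differentiable_continuous; apply/derivable1_diffP; case: (dH t).
rewrite (@continuous_FTC2 _ h H) //.
- exact: continuous_subspaceT.
- split; first by move=> t _; case: (dH t).
  + exact: cvg_at_right_filter (cH 0).
  + exact: cvg_at_left_filter (cH _).
- by move=> t _; rewrite derive1E; case: (dH t).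
Qed.

(** The integral over the angle, without the factor of the complex line element. *)
Definition cint phi : C :=
  rint (fun t => complex.Re (phi (cis t))) +i*
  rint (fun t => complex.Im (phi (cis t))).

Lemma eq_cint phi psi : (forall u, N u = 1 -> phi u = psi u) ->
  cint phi = cint psi.
Proof.
move=> e; rewrite /cint; congr (_ +i* _); apply: eq_Rintegral => t _;
  by rewrite e // nc_cis.
Qed.

Lemma cintD phi psi : ucont phi -> ucont psi ->
  cint (fun u => phi u + psi u) = cint phi + cint psi.
Proof.
move=> cphi cpsi; rewrite /cint /rint.
have ReD : forall z w, complex.Re (z + w) = complex.Re z + complex.Re w.
  by move=> [a b] [x y].
have ImD : forall z w, complex.Im (z + w) = complex.Im z + complex.Im w.
  by move=> [a b] [x y].
under eq_Rintegral do rewrite ReD.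
rewrite RintegralD //; [|exact/integrable_J/ucont_Re..].
rewrite [in X in _ +i* X](eq_fun (fun t => ImD (phi (cis t)) (psi (cis t)))).
by rewrite RintegralD //; exact/integrable_J/ucont_Im.
Qed.

Lemma cintZ (k : C) phi : ucont phi -> cint (fun u => k * phi u) = k * cint phi.
Proof.
move=> cphi; rewrite /cint /rint; case: k => a b.
have ReM z : complex.Re ((a +i* b) * z) = a * complex.Re z - b * complex.Im z.
  by case: z.
have ImM z : complex.Im ((a +i* b) * z) = a * complex.Im z + b * complex.Re z.
  by case: z.
rewrite (eq_fun (fun t => ReM (phi (cis t)))) (eq_fun (fun t => ImM (phi (cis t)))).
have cr := ucont_Re cphi; have ci := ucont_Im cphi.
have cm (k : R) h : continuous h -> mu.-integrable J (EFin \o (fun t => k * h t)).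
  move=> ch; apply: integrable_J => t.
  by apply: cvgM; [exact: cvg_cst|exact: ch].
rewrite RintegralB ?RintegralD //; [|exact: cm..].
by rewrite !RintegralZl //; exact: integrable_J.
Qed.

Lemma cint_bound phi M : ucont phi -> (forall u, N u = 1 -> N (phi u) <= M) ->
  N (cint phi) <= 4 * pi * M.
Proof.
move=> cphi phiM; apply: le_trans (nc_le_ReIm _) _.
have h1 := rint_bound (ucont_Re cphi)
  (fun t => le_trans (nc_Re _) (phiM _ (nc_cis t))).
have h2 := rint_bound (ucont_Im cphi)
  (fun t => le_trans (nc_Im _) (phiM _ (nc_cis t))).
apply: le_trans (lerD h1 h2) _.
by rewrite le_eqVlt; apply/orP; left; apply/eqP; ring.
Qed.

Lemma cint_cst (k : C) : cint (fun=> k) = k * (pi *+ 2)%:C.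
Proof.
rewrite /cint !rint_cst; case: k => a b /=.
by apply/eqP; rewrite eq_complex /= !mulr0 subr0 add0r !eqxx.
Qed.

(** The integrand is, up to the factor i, the derivative of the periodic function
    G (cis t). *)
Lemma cint_exact G g : (forall u, N u = 1 -> cder G u (g u)) -> ucont g ->
  cint (fun u => g u * u) = 0.
Proof.
move=> dG cg.
have cgu : ucont (fun u => g u * u).
  by move=> u u1; apply: contM (cg u u1) _; exact: cont_id.
suff : cint (fun u => 'i%C * (g u * u)) = 0.
  rewrite cintZ // => /eqP; rewrite mulf_eq0 => /orP[|/eqP //].
  by rewrite eq_complex /= oner_eq0 andbF.
have dGc t : vder (fun s => G (cis s)) t (1 : R) ('i%C * (g (cis t) * cis t)).
  rewrite mulrCA; apply: vder_comp; first exact: vder_cis.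
  by apply: dG; exact: nc_cis.
have cigu : ucont (fun u => 'i%C * (g u * u)).
  by move=> u u1; apply: contM (cont_cst _ _) (cgu u u1).
rewrite /cint.
rewrite (rint_exact (fun t => (dGc t).1) (ucont_Re cigu)).
rewrite (rint_exact (fun t => (dGc t).2) (ucont_Im cigu)).
by rewrite cis_2pi !subrr.
Qed.

Let rint_param (F dF : R -> R -> R) (a b M : R) : a < 0 -> 1 < b ->
  (forall t, a < t < b -> continuous (F t)) ->
  (forall t x, a < t < b -> is_derive t (1 : R) (F ^~ x) (dF t x)) ->
  (forall t x, a < t < b -> `|dF t x| <= M) ->
  (forall t, a < t < b -> rint (dF t) = 0) ->
  rint (F 0) = rint (F 1).
Proof.
move=> a0 b1 cF dFF dM d0.
have dphi t : a < t < b -> is_derive t (1 : R) (fun s => rint (F s)) 0.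
  move=> tab; have Ia : `]a, b[%classic t by rewrite /= in_itv.
  have E s x : a < s < b -> partial1of2 F s x = dF s x.
    by move=> sab; rewrite partial1of2E; case: (dFF s x sab).
  have iF s : `]a, b[%classic s -> mu.-integrable J (EFin \o F s).
    by rewrite /= in_itv /= => sab; apply: integrable_J; exact: cF.
  have dF1 s x : `]a, b[%classic s -> J x -> derivable (F ^~ x) s 1.
    by rewrite /= in_itv /= => sab _; case: (dFF s x sab).
  have M0 (y : R) : 0 <= M by apply: le_trans (dM t y tab); exact: normr_ge0.
  have iM : mu.-integrable J (EFin \o (fun=> M)).
    by apply: integrable_J => s; exact: cvg_cst.
  have bM s x : `]a, b[%classic s -> J x -> `|partial1of2 F s x| <= M.
    by rewrite /= in_itv /= => sab _; rewrite E //; exact: dM.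
  split.
    exact: (@derivable_under_integral _ _ _ mu F J measurable_J t a b Ia iF dF1
      (fun=> M) M0 iM bM).
  rewrite -derive1E.
  rewrite (@differentiation_under_integral _ _ _ mu F J measurable_J t a b Ia iF
    dF1 (fun=> M) M0 iM bM).
  transitivity (rint (dF t)); last exact: d0.
  by apply: eq_Rintegral => x _; exact: E.
have D (t : R) : t \in `]0, 1[%R -> is_derive t (1 : R) (fun s => rint (F s)) (cst 0 t).
  rewrite in_itv /= => /andP[t0 t1]; apply: dphi.
  by rewrite (lt_trans a0 t0) (lt_trans t1 b1).
have W : {within `[0, 1], continuous (fun s => rint (F s))}.
  apply: continuous_in_subspaceT => t /set_mem /=; rewrite in_itv /= => /andP[t0 t1].
  apply: differentiable_continuous; apply/derivable1_diffP.
  by have [] := dphi t; rewrite ?(lt_le_trans a0 t0) ?(le_lt_trans t1 b1).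
have [x _] := MVT_segment ler01 D W.
by rewrite mul0r => /eqP; rewrite subr_eq0 => /eqP.
Qed.

(** Differentiation under the integral sign gives the integral, as a function of
    t, the derivative zero. *)
Lemma cint_param (F dF : R -> C -> C) (a b M : R) : a < 0 -> 1 < b ->
  (forall t, a < t < b -> ucont (F t)) ->
  (forall t u, a < t < b -> N u = 1 -> vder (F ^~ u) t (1 : R) (dF t u)) ->
  (forall t u, a < t < b -> N u = 1 -> N (dF t u) <= M) ->
  (forall t, a < t < b -> cint (dF t) = 0) ->
  cint (F 0) = cint (F 1).
Proof.
move=> a0 b1 cF dF1 dM d0; rewrite /cint; congr (_ +i* _).
- apply: (rint_param (F := fun t x => complex.Re (F t (cis x)))
    (dF := fun t x => complex.Re (dF t (cis x))) (M := M) a0 b1).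
  + by move=> t /cF /ucont_Re.
  + by move=> t x /dF1 /(_ (nc_cis x))[].
  + by move=> t x /dM /(_ (nc_cis x)); exact: le_trans (nc_Re _).
  + by move=> t /d0 /(congr1 (@complex.Re R)).
- apply: (rint_param (F := fun t x => complex.Im (F t (cis x)))
    (dF := fun t x => complex.Im (dF t (cis x))) (M := M) a0 b1).
  + by move=> t /cF /ucont_Im.
  + by move=> t x /dF1 /(_ (nc_cis x))[].
  + by move=> t x /dM /(_ (nc_cis x)); exact: le_trans (nc_Im _).
  + by move=> t /d0 /(congr1 (@complex.Im R)).
Qed.

Lemma circle_bounded phi : ucont phi ->
  exists2 M, 0 <= M & forall u, N u = 1 -> N (phi u) <= M.
Proof.
move=> cphi.
have cK : compact [set u : C | N u = 1].
  have cD := @compact_cdisc R 0 1.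
  apply: (subclosed_compact _ cD) => [|u]; last first.
    by rewrite /= subr0 => ->.
  rewrite -[X in closed X]/((fun z : C => N z) @^-1` [set 1]).
  apply: closed_comp; first by move=> z _; exact: continuous_nc.
  exact: closed_eq.
have cI : compact ((fun z => N (phi z)) @` [set u : C | N u = 1]).
  apply: continuous_compact cK.
  apply: continuous_in_subspaceT => z /set_mem /= /cphi cz.
  by move=> A /continuous_nc /(ccontP cz).
have [M [_ MP]] := compact_bounded cI.
exists (`|M| + 1) => [|u u1]; first by rewrite addr_ge0.
apply: le_trans (ler_norm _) _.
apply: (MP (`|M| + 1)); last by exists u.
by rewrite ltr_pwDr // ler_norm.
Qed.

End CircleIntegral.

(** * Cauchy's formula and its consequences *)

Section Cauchy.
Variable R : realType.
Local Notation C := (Cx R).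
Local Notation N := (@Normc.normc R).
Implicit Types (z w c l u : C) (f g phi psi : C -> C) (r : R).

Lemma ccont_lipschitz f z (r M : R) : 0 < r ->
  (forall w, N (w - z) < r -> N (f w - f z) <= M * N (w - z)) -> ccont f z.
Proof.
move=> r0 fM; split=> A /nbhsC[e e0 eA].
have M1 : 0 < `|M| + 1 by rewrite ltr_pwDr.
apply/nbhsC; exists (Num.min r (e / (`|M| + 1))).
  by rewrite lt_min r0 divr_gt0.
move=> w; rewrite lt_min => /andP[wr we]; apply: eA.
apply: le_lt_trans (fM w wr) _; move: we; rewrite ltr_pdivlMr // => we.
apply: le_lt_trans we; rewrite mulrC ler_wpM2l ?nc_ge0 //.
by rewrite (le_trans (ler_norm _)) // lerDl.
Qed.

Lemma cder_quadratic f z l (r M : R) : 0 < r ->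
  (forall w, N (w - z) < r ->
    N (f w - f z - l * (w - z)) <= M * N (w - z) ^+ 2) -> cder f z l.
Proof.
move=> r0 fM; exists (fun w => if w == z then l else (f w - f z) / (w - z)).
split; first by rewrite eqxx.
  apply: (ccont_lipschitz (M := M) r0) => w wr; rewrite eqxx.
  case: eqVneq => [->|wz]; first by rewrite !subrr nc0 mulr0.
  have wz0 : w - z != 0 by rewrite subr_eq0.
  rewrite -(ler_pM2r (x := N (w - z))) ?nc_gt0 // -ncM.
  rewrite mulrBl divfK // -mulrA -expr2; exact: fM.
near=> w; case: eqVneq => [->|wz]; first by rewrite subrr mulr0 addr0.
by rewrite divfK ?subr_eq0 // addrC subrK.
Unshelve. all: by end_near. Qed.

Definition cD f z : C := xget 0 [set l | cder f z l].

Lemma cDE f z l : cder f z l -> cD f z = l.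
Proof.
move=> fl; rewrite /cD; case: xgetP => [x -> /= fx|/(_ l)] //.
exact: cder_unique fx fl.
Qed.

Lemma holo_cDP f z : holo_at f z -> cder f z (cD f z).
Proof. by move=> /holo_cder[l fl]; rewrite (cDE fl). Qed.

Lemma holo_cD_cont f z : holo_at f z -> ccont (cD f) z.
Proof.
move=> [f' [df cf']]; apply: cont_near cf' _.
by apply: filterS df => w /cDE ->.
Qed.

Definition hol (U : set C) f := forall z, U z -> holo_at f z.

Lemma circle_den c r w u : N u = 1 -> 0 < r ->
  r - N (w - c) <= N (c + r%:C * u - w).
Proof.
move=> u1 r0; have -> : c + r%:C * u - w = r%:C * u - (w - c) by ring.
apply: le_trans (ncB_ge _ _).
by rewrite ncM u1 mulr1 ncR gtr0_norm.
Qed.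

Lemma circle_den_neq0 c r w u : N u = 1 -> disc c r w -> c + r%:C * u - w != 0.
Proof.
move=> u1 wr; have r0 : 0 < r := le_lt_trans (nc_ge0 _) wr.
rewrite -nc_gt0; apply: lt_le_trans (circle_den c w u1 r0).
by rewrite subr_gt0.
Qed.

Lemma vder_real (t : R) : vder (fun s : R => s%:C : C) t (1 : R) 1.
Proof. by split; [exact: is_derive_id|exact: is_derive_cst]. Qed.

Lemma cont_affine (a b z : C) : ccont (fun w => a + b * w) z.
Proof. by apply: contD (cont_cst _ _) (contM (cont_cst _ _) (cont_id _)). Qed.

Lemma cder_affine (a b z : C) : cder (fun w => a + b * w) z b.
Proof.
have := cderD (cder_cst a z) (cderZ b (cder_id z)).
by rewrite add0r mulr1.
Qed.

(** The centre of the kernel is moved from c to w: the derivative in the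
    parameter t is exact on the circle, and for t = 0 the integrand is 1. *)
Lemma cint_kernel c r w : disc c r w ->
  cint (fun u => r%:C * u / (c + r%:C * u - w)) = (pi *+ 2)%:C.
Proof.
move=> wr; have r0 : 0 < r := le_lt_trans (nc_ge0 _) wr.
pose d := N (w - c); have d0 : 0 <= d := nc_ge0 _.
have dr : d < r by [].
(* e is chosen such that (1 + e) d stays below r *)
pose e := (r - d) / (2 * r); have e0 : 0 < e by rewrite divr_gt0; lra.
have er : e * r = (r - d) / 2 by rewrite /e; field; lra.
pose q := (r + d) / 2.
have tq (t : R) : - e < t < 1 + e -> `|t| * d <= q.
  move=> /andP[t1 t2]; have t3 : `|t| <= 1 + e.
    by rewrite ler_norml; apply/andP; split; lra.
  apply: le_trans (ler_wpM2r d0 t3) _.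
  rewrite mulrDl mul1r /q.
  have : e * d <= e * r by rewrite ler_wpM2l; lra.
  by rewrite er; lra.
have den (t : R) u : - e < t < 1 + e -> N u = 1 ->
    r - q <= N (r%:C * u - t%:C * (w - c)).
  move=> /tq tt u1; apply: le_trans (ncB_ge _ _).
  by rewrite !ncM u1 mulr1 !ncR gtr0_norm // lerD2l lerN2.
have rq : 0 < r - q by rewrite /q; lra.
have den0 (t : R) u : - e < t < 1 + e -> N u = 1 ->
    r%:C * u - t%:C * (w - c) != 0.
  by move=> tt u1; rewrite -nc_gt0; apply: lt_le_trans (den t u tt u1).
pose F (t : R) u : C := r%:C * u / (r%:C * u - t%:C * (w - c)).
pose dF (t : R) u : C :=
  r%:C * (w - c) / (r%:C * u - t%:C * (w - c)) ^+ 2 * u.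
have cden (t : R) u : ccont (fun u => r%:C * u - t%:C * (w - c)) u.
  by apply: contB (cont_cst _ _); apply: contM (cont_cst _ _) (cont_id _).
have F01 : cint (F 0) = cint (F 1).
  apply: (@cint_param R F dF (- e) (1 + e) (r * d / (r - q) ^+ 2)).
  - by rewrite oppr_lt0.
  - by rewrite ltrDl.
  - move=> t tt u u1; apply: contM.
      by apply: contM (cont_cst _ _) (cont_id _).
    by apply: contV; [exact: den0|exact: cden].
  - move=> t u tt u1.
    have h : cder (fun x => r%:C * u * (r%:C * u - x * (w - c))^-1) t%:C (dF t u).
      have h1 := cderM (cder_id t%:C) (cder_cst (w - c) t%:C).
      have h2 := cderB (cder_cst (r%:C * u) t%:C) h1.
      have h3 := cderZ (r%:C * u)
        (cderV (f := fun x => r%:C * u - x * (w - c)) (den0 t u tt u1) h2).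
      rewrite (_ : dF t u = r%:C * u * (- (0 - (1 * (w - c) + t%:C * 0)) /
        (r%:C * u - t%:C * (w - c)) ^+ 2)); first exact: h3.
      by rewrite /dF; field; exact: den0.
    by have := vder_comp (vder_real t) h; rewrite mulr1.
  - move=> t u tt u1; rewrite /dF !ncM ncV ncX u1 mulr1 ncR gtr0_norm //.
    rewrite -/d; apply: ler_wpM2l; first by rewrite mulr_ge0 // ltW.
    have dn := den t u tt u1.
    have dn0 := lt_le_trans rq dn.
    by rewrite lef_pV2 ?posrE ?exprn_gt0 // ler_pXn2r // nnegrE ltW.
  move=> t tt; rewrite /dF.
  apply: (cint_exact (G := fun u => - (w - c) * (r%:C * u - t%:C * (w - c))^-1)).
    move=> u u1.
    have h2 := cderB (cderZ r%:C (cder_id u)) (cder_cst (t%:C * (w - c)) u).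
    have h3 := cderZ (- (w - c))
      (cderV (f := fun u => r%:C * u - t%:C * (w - c)) (den0 t u tt u1) h2).
    rewrite (_ : _ / _ = - (w - c) * (- (r%:C * 1 - 0) /
        (r%:C * u - t%:C * (w - c)) ^+ 2)); first exact: h3.
    by field; exact: den0.
  move=> u u1; apply: contM (cont_cst _ _) _.
  under eq_fun do rewrite expr2.
  apply: contV; first by rewrite mulf_neq0 ?den0.
  by apply: contM; exact: cden.
have F1 : cint (fun u => r%:C * u / (c + r%:C * u - w)) = cint (F 1).
  by apply: eq_cint => u u1; rewrite /F; congr (_ / _); ring.
rewrite F1 -F01 (_ : cint (F 0) = cint (fun=> 1)); last first.
  apply: eq_cint => u u1; rewrite /F mul0r subr0 divff // mulf_neq0 //.
    by rewrite -nc_eq0 ncR normr_eq0 gt_eqF.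
  by rewrite -nc_eq0 u1 oner_eq0.
by rewrite cint_cst mul1r.
Qed.

(** The values of f on the circle are contracted to w along segments: the
    derivative in t of f (w + t (zeta - w)) (zeta - c) / (zeta - w) is exact on
    the circle for every t, so the integral for t = 1 equals the one for t = 0. *)
Lemma cauchy_formula f c r r' w : r < r' -> hol (disc c r') f -> disc c r w ->
  cint (fun u => f (c + r%:C * u) * (r%:C * u / (c + r%:C * u - w))) =
  f w * (pi *+ 2)%:C.
Proof.
move=> rr' hf wr; have r0 : 0 < r := le_lt_trans (nc_ge0 _) wr.
(* parameters slightly outside [0, 1] keep the contracted circle in the disc of
   radius r2 *)
pose e := (r' - r) / (4 * r); have e0 : 0 < e by rewrite divr_gt0; lra.
pose r2 := (r + r') / 2.
have er : (1 + 2 * e) * r = r2 by rewrite /e /r2; field; lra.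
pose P (t : R) u : C := w + t%:C * (c + r%:C * u - w).
have Pr2 (t : R) u : - e < t < 1 + e -> N u = 1 -> N (P t u - c) <= r2.
  move=> /andP[t1 t2] u1.
  have -> : P t u - c = (1 - t)%:C * (w - c) + t%:C * (r%:C * u).
    by rewrite /P rmorphB rmorph1; ring.
  apply: le_trans (ncD _ _) _; rewrite !ncM !ncR u1 mulr1 (gtr0_norm r0) -er.
  apply: (@le_trans _ _ (`|1 - t| * r + `|t| * r)).
    by rewrite lerD2r ler_wpM2l // ltW.
  rewrite -mulrDl ler_pM2r //.
  by case: (ger0P (1 - t)) => h1; case: (ger0P t) => h2; lra.
have r2r' : r2 < r' by rewrite /r2; lra.
have hP (t : R) u : - e < t < 1 + e -> N u = 1 -> holo_at f (P t u).
  by move=> tt u1; apply: hf; exact: le_lt_trans (Pr2 t u tt u1) r2r'.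
have [M Mf] : exists M, forall z, N (z - c) <= r2 -> N (cD f z) <= M.
  apply: cdisc_bounded => z zr2.
  by case: (holo_cD_cont (hf z (le_lt_trans zr2 r2r'))).
pose F (t : R) u : C := f (P t u) * (r%:C * u / (c + r%:C * u - w)).
pose dF (t : R) u : C := cD f (P t u) * r%:C * u.
have cP (t : R) u : ccont (P t) u.
  apply: contD (cont_cst _ _) (contM (cont_cst _ _) _).
  by apply: contB (cont_cst _ _); exact: cont_affine.
have cdF (t : R) u : - e < t < 1 + e -> N u = 1 ->
    ccont (fun u => cD f (P t u) * r%:C) u.
  move=> tt u1; apply: contM (cont_cst _ _).
  by apply: cont_comp (cP t u) _; exact: holo_cD_cont (hP t u tt u1).
have F01 : cint (F 0) = cint (F 1).
  apply: (@cint_param R F dF (- e) (1 + e) (M * r)).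
  - by rewrite oppr_lt0.
  - by rewrite ltrDl.
  - move=> t tt u u1; apply: contM.
      by apply: cont_comp (cP t u) _; exact: holo_cont (hP t u tt u1).
    apply: contM; first by apply: contM (cont_cst _ _) (cont_id _).
    apply: contV; first exact: circle_den_neq0.
    by apply: contB (cont_cst _ _); exact: cont_affine.
  - move=> t u tt u1; have a0 := circle_den_neq0 u1 wr.
    pose a := c + r%:C * u - w; rewrite -/a in a0.
    have h : cder (fun x => f (w + x * a) * (r%:C * u / a)) t%:C (dF t u).
      have h1 := cderD (cder_cst w t%:C)
        (cderM (cder_id t%:C) (cder_cst a t%:C)).
      have h2 := cder_comp h1 (holo_cDP (hP t u tt u1)).
      have h3 := cderM h2 (cder_cst (r%:C * u / a) t%:C).
      rewrite (_ : dF t u = cD f (P t u) * (0 + (1 * a + t%:C * 0)) *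
        (r%:C * u / a) + f (w + t%:C * a) * 0); first exact: h3.
      by rewrite /dF; field.
    by have := vder_comp (vder_real t) h; rewrite mulr1.
  - move=> t u tt u1; rewrite /dF !ncM u1 mulr1 ncR gtr0_norm //.
    by rewrite ler_pM2r //; apply: Mf; exact: Pr2.
  move=> t tt; rewrite /dF.
  have [t0|t0] := eqVneq t 0.
    apply: (cint_exact (G := fun u => cD f w * r%:C * u)); last first.
      by move=> u u1; exact: cdF.
    move=> u u1; rewrite t0 /P mul0r addr0.
    by have := cderZ (cD f w * r%:C) (cder_id u); rewrite mulr1.
  apply: (cint_exact (G := fun u => f (P t u) * t^-1%:C)); last first.
    by move=> u u1; exact: cdF.
  move=> u u1.
  have h0 := cderD (cder_cst w u) (cderZ t%:C (cderB (cder_affine c r%:C u) (cder_cst w u))).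
  have h1 := cderM (cder_comp h0 (holo_cDP (hP t u tt u1))) (cder_cst t^-1%:C u).
  rewrite (_ : _ * _ = cD f (P t u) * (0 + t%:C * (r%:C - 0)) * t^-1%:C +
    f (P t u) * 0); first exact: h1.
  rewrite mulr0 addr0 add0r subr0 [t%:C * _]mulrC -!mulrA -rmorphM.
  by rewrite divff // rmorph1 mulr1.
have F1 : cint (fun u => f (c + r%:C * u) * (r%:C * u / (c + r%:C * u - w))) =
    cint (F 1).
  apply: eq_cint => u u1; rewrite /F /P; congr (f _ * _); rewrite mul1r; ring.
rewrite F1 -F01 -(cint_kernel wr) -cintZ.
  by apply: eq_cint => u u1; rewrite /F /P mul0r addr0.
move=> u u1; apply: contM; first by apply: contM (cont_cst _ _) (cont_id _).
apply: contV; first exact: circle_den_neq0.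
by apply: contB (cont_cst _ _); exact: cont_affine.
Qed.


(** For k = 1, the Cauchy transform of a density on the circle of centre c and
    radius r; higher exponents give its derivatives up to a factor. *)
Definition ctr phi c r (k : nat) w : C :=
  cint (fun u => phi u / (c + r%:C * u - w) ^+ k).

Lemma ucont_kernel phi c r w k : ucont phi -> disc c r w ->
  ucont (fun u => phi u * ((c + r%:C * u - w) ^+ k)^-1).
Proof.
move=> cphi wr u u1; apply: contM; first exact: cphi.
apply: contV; first by rewrite expf_neq0 // circle_den_neq0.
elim: k => [|k IH]; first by under eq_fun do rewrite expr0; exact: cont_cst.
under eq_fun do rewrite exprS.
by apply: contM _ IH; apply: contB (cont_cst _ _); exact: cont_affine.
Qed.

(** The estimates for the kernel are polynomial in the two reciprocals a and b,
    through the resolvent identity a - b = (w - z) a b. *)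
Lemma kernel_bounds c r z : disc c r z -> exists2 s, 0 < s & exists2 D, 0 <= D &
  forall w, N (w - z) < s -> disc c r w /\
  forall u, N u = 1 -> exists a b : C,
    [/\ (c + r%:C * u - w)^-1 = a, (c + r%:C * u - z)^-1 = b,
        a - b = (w - z) * a * b, N a <= D & N b <= D].
Proof.
move=> zr; have r0 : 0 < r := le_lt_trans (nc_ge0 _) zr.
pose s := (r - N (z - c)) / 2; have zr' : N (z - c) < r by [].
have s0 : 0 < s by rewrite /s; lra.
exists s => //; exists s^-1; first by rewrite invr_ge0 ltW.
move=> w wz.
have ws : N (w - c) + s < r.
  have : N (w - c) <= N (w - z) + N (z - c).
    by rewrite (_ : w - c = (w - z) + (z - c)); [exact: ncD|ring].
  by move: wz; rewrite /s; lra.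
have wr : disc c r w by rewrite /disc /=; lra.
split=> // u u1.
exists (c + r%:C * u - w)^-1, (c + r%:C * u - z)^-1.
have h1 := circle_den_neq0 u1 wr; have h2 := circle_den_neq0 u1 zr.
have n1 := circle_den c w u1 r0; have n2 := circle_den c z u1 r0.
split=> //; first by field; rewrite h1 h2.
- by rewrite ncV lef_pV2 ?posrE ?nc_gt0 //; lra.
- by rewrite ncV lef_pV2 ?posrE ?nc_gt0 //; move: s0 n2; rewrite /s; lra.
Qed.

(** Estimates for the kernel, uniform on the circle, pass to Cauchy transforms. *)
Lemma ctr_bound phi c r k1 k2 k3 z w (h m : C) (M E : R) : ucont phi ->
  disc c r w -> disc c r z -> 0 <= M -> 0 <= E ->
  (forall u, N u = 1 -> N (phi u) <= M) ->
  (forall u, N u = 1 -> N (((c + r%:C * u - w)^-1) ^+ k1 -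
    m * ((c + r%:C * u - z)^-1) ^+ k2 - h * ((c + r%:C * u - z)^-1) ^+ k3) <= E) ->
  N (ctr phi c r k1 w - m * ctr phi c r k2 z - h * ctr phi c r k3 z) <=
    4 * pi * (M * E).
Proof.
move=> cphi wr zr M0 E0 phiM kE; have K v k := @ucont_kernel phi c r v k cphi.
have Z (a : C) v k : disc c r v ->
    ucont (fun u => a * (phi u * ((c + r%:C * u - v) ^+ k)^-1)).
  by move=> vr u u1; apply: contM (cont_cst _ _) (K v k vr u u1).
have -> : forall a b x : C, a - b - x = a + ((-1) * b + (-1) * x).
  by move=> a b x; ring.
have Z2 : ucont (fun u => - 1 * m * (phi u / (c + r%:C * u - z) ^+ k2) +
    - 1 * h * (phi u / (c + r%:C * u - z) ^+ k3)).
  by move=> u u1; apply: contD; exact: Z.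
rewrite !mulrA -!cintZ -?cintD; try exact: K; try exact: Z; try exact: Z2.
rewrite -[leRHS]mulrA; apply: cint_bound => [u u1|u u1].
  by apply: contD; [exact: K | exact: Z2].
rewrite -!exprVn (_ : _ + _ = phi u * (((c + r%:C * u - w)^-1) ^+ k1 -
    m * ((c + r%:C * u - z)^-1) ^+ k2 - h * ((c + r%:C * u - z)^-1) ^+ k3)).
  by rewrite ncM; apply: ler_pM; rewrite ?nc_ge0 ?phiM ?kE.
by ring.
Qed.

Lemma ctr_cder1 phi c r z : ucont phi -> disc c r z ->
  cder (ctr phi c r 1) z (ctr phi c r 2 z).
Proof.
move=> cphi zr; have [M M0 phiM] := circle_bounded cphi.
have [s s0 [D D0 sD]] := kernel_bounds zr.
apply: (@cder_quadratic _ _ _ s (4 * pi * (M * D ^+ 3)) s0) => w wz.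
have [wr bd] := sD w wz.
rewrite [_ * (w - z)]mulrC -[X in _ - X - _]mul1r.
have -> : 4 * pi * (M * D ^+ 3) * N (w - z) ^+ 2 =
  4 * pi * (M * (D ^+ 3 * N (w - z) ^+ 2)) by ring.
have W0 := nc_ge0 (w - z).
apply: ctr_bound => // [|u u1]; first by rewrite mulr_ge0 ?exprn_ge0.
have [a [b [-> -> ab aD bD]]] := bd u u1.
have -> : a ^+ 1 - 1 * b ^+ 1 - (w - z) * b ^+ 2 = (a - b) - (w - z) * b * b.
  by ring.
have -> : (a - b) - (w - z) * b * b = (w - z) ^+ 2 * (a * b * b).
  rewrite {1}ab; have -> : (w - z) * a * b - (w - z) * b * b =
    (w - z) * b * (a - b) by ring.
  by rewrite ab; ring.
rewrite ncM ncX mulrC ler_wpM2r ?exprn_ge0 // !ncM !exprS expr0 mulr1 mulrA.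
by do 2!(apply: ler_pM; rewrite ?mulr_ge0 ?nc_ge0 //).
Qed.

Lemma ctr_cder2 phi c r z : ucont phi -> disc c r z ->
  cder (ctr phi c r 2) z (2 * ctr phi c r 3 z).
Proof.
move=> cphi zr; have [M M0 phiM] := circle_bounded cphi.
have [s s0 [D D0 sD]] := kernel_bounds zr.
apply: (@cder_quadratic _ _ _ s (4 * pi * (M * (3 * D ^+ 4))) s0) => w wz.
have [wr bd] := sD w wz.
rewrite [_ * (w - z)]mulrC -[X in _ - X - _]mul1r [(w - z) * _]mulrA.
have -> : 4 * pi * (M * (3 * D ^+ 4)) * N (w - z) ^+ 2 =
  4 * pi * (M * (3 * D ^+ 4 * N (w - z) ^+ 2)) by ring.
have W0 := nc_ge0 (w - z).
apply: ctr_bound => // [|u u1]; first by rewrite !mulr_ge0 ?exprn_ge0.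
have [a [b [-> -> ab aD bD]]] := bd u u1.
have -> : a ^+ 2 - 1 * b ^+ 2 - (w - z) * 2 * b ^+ 3 =
    (w - z) ^+ 2 * (a * b * b * (a + 2 * b)).
  transitivity ((a - b) * (a + b) - (w - z) * 2 * b ^+ 3); first by ring.
  rewrite {1}ab.
  transitivity ((w - z) * b * ((a - b) * (a + 2 * b))); first by ring.
  by rewrite ab; ring.
rewrite ncM ncX mulrC ler_wpM2r ?exprn_ge0 // !ncM.
have -> : 3 * D ^+ 4 = D * D * D * (3 * D) by ring.
have e2 : N (a + 2 * b) <= 3 * D.
  apply: le_trans (ncD _ _) _; rewrite ncM.
  by rewrite (_ : N 2 = 2); [lra | rewrite -[2 in LHS](rmorph_nat (real_complex R)) ncR ger0_norm].
by apply: ler_pM e2; rewrite ?mulr_ge0 ?nc_ge0 //;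
  do 2!(apply: ler_pM; rewrite ?mulr_ge0 ?nc_ge0 //).
Qed.

Lemma ctr_cont3 phi c r z : ucont phi -> disc c r z -> ccont (ctr phi c r 3) z.
Proof.
move=> cphi zr; have [M M0 phiM] := circle_bounded cphi.
have [s s0 [D D0 sD]] := kernel_bounds zr.
apply: (@ccont_lipschitz _ _ s (4 * pi * (M * (3 * D ^+ 4))) s0) => w wz.
have [wr bd] := sD w wz.
have -> : ctr phi c r 3 w - ctr phi c r 3 z =
  ctr phi c r 3 w - 1 * ctr phi c r 3 z - 0 * ctr phi c r 3 z.
  by rewrite mul0r subr0 mul1r.
have -> : 4 * pi * (M * (3 * D ^+ 4)) * N (w - z) =
  4 * pi * (M * (3 * D ^+ 4 * N (w - z))) by ring.
have W0 := nc_ge0 (w - z).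
apply: ctr_bound => // [|u u1]; first by rewrite !mulr_ge0 ?exprn_ge0.
have [a [b [-> -> ab aD bD]]] := bd u u1.
have -> : a ^+ 3 - 1 * b ^+ 3 - 0 * b ^+ 3 =
    (w - z) * (a * b * (a * a + a * b + b * b)).
  transitivity ((a - b) * (a * a + a * b + b * b)); first by ring.
  by rewrite ab; ring.
rewrite ncM mulrC ler_wpM2r //.
have -> : 3 * D ^+ 4 = D * D * (D * D + D * D + D * D) by ring.
have P x y : N x <= D -> N y <= D -> N (x * y) <= D * D.
  by move=> xD yD; rewrite ncM; apply: ler_pM; rewrite ?nc_ge0.
rewrite ncM; apply: ler_pM; rewrite ?nc_ge0 //; first exact: P.
apply: le_trans (ncD _ _) _; apply: lerD; last exact: P.
by apply: le_trans (ncD _ _) _; apply: lerD; exact: P.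
Qed.

Lemma ctr_hol1 phi c r : ucont phi -> hol (disc c r) (ctr phi c r 1).
Proof.
move=> cphi z zr; exists (ctr phi c r 2); split.
  by apply: filterS (disc_nbhs zr) => w; exact: ctr_cder1.
exact: cder_continuous (ctr_cder2 cphi zr).
Qed.

Lemma ctr_hol2 phi c r : ucont phi -> hol (disc c r) (ctr phi c r 2).
Proof.
move=> cphi z zr; exists (fun z => 2 * ctr phi c r 3 z); split.
  by apply: filterS (disc_nbhs zr) => w; exact: ctr_cder2.
by apply: contM (cont_cst _ _) _; exact: ctr_cont3.
Qed.

(** By Cauchy's formula, the density on the circle whose Cauchy transform is f. *)
Definition density f c r u : C :=
  (pi *+ 2)^-1%:C * (f (c + r%:C * u) * (r%:C * u)).

Lemma circle_disc c r r' u : 0 < r -> r < r' -> N u = 1 ->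
  disc c r' (c + r%:C * u).
Proof.
move=> r0 rr' u1; rewrite /disc /= [c + _]addrC addrK ncM u1 mulr1 ncR.
by rewrite gtr0_norm.
Qed.

Lemma ucont_density f c r : (forall u, N u = 1 -> ccont f (c + r%:C * u)) ->
  ucont (density f c r).
Proof.
move=> cf u u1; apply: contM (cont_cst _ _) _; apply: contM.
  by apply: cont_comp (cont_affine c r%:C u) _; exact: cf.
by apply: contM (cont_cst _ _) (cont_id _).
Qed.

Lemma pi2C : (pi *+ 2)%:C != 0 :> C.
Proof. by rewrite -nc_eq0 ncR normr_eq0 mulrn_eq0 /= gt_eqF // pi_gt0. Qed.

Lemma cauchy f c r r' w : r < r' -> hol (disc c r') f -> disc c r w ->
  f w = ctr (density f c r) c r 1 w.
Proof.
move=> rr' hf wr; have r0 : 0 < r := le_lt_trans (nc_ge0 _) wr.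
apply: (mulIf pi2C); rewrite -(cauchy_formula rr' hf wr) mulrC.
rewrite /ctr /density -cintZ.
  apply: eq_cint => u u1; rewrite expr1 -!mulrA [RHS]mulrA -rmorphM.
  by rewrite mulfV ?rmorph1 ?mul1r // mulrn_eq0 /= gt_eqF // pi_gt0.
have cf u : N u = 1 -> ccont f (c + r%:C * u).
  by move=> u1; apply: holo_cont; apply: hf; exact: circle_disc.
exact: (@ucont_kernel (density f c r) c r w 1 (ucont_density cf) wr).
Qed.

Lemma hol_shrink f c r r' : r < r' -> hol (disc c r') f -> 0 < r ->
  ucont (density f c r).
Proof.
move=> rr' hf r0; apply: ucont_density => u u1; apply: holo_cont.
by apply: hf; exact: circle_disc.
Qed.

(** By Cauchy's formula the derivative is again given by an integral whose kernel
    can be differentiated. *)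
Lemma holo_cD f z : (\forall w \near z, holo_at f w) -> holo_at (cD f) z.
Proof.
move=> /nbhsC[r r0 hf]; have hd : hol (disc z r) f by [].
have r2 : 0 < r / 2 by rewrite divr_gt0.
have r2r : r / 2 < r by lra.
have ud := hol_shrink r2r hd r2.
apply: holo_near (ctr_hol2 ud (disc_center _ r2)) _.
apply: filterS (near_join (disc_nbhs (disc_center z r2))) => w wd.
rewrite (@cDE f w (ctr (density f z (r / 2)) z (r / 2) 2 w)) //.
apply: cder_near (ctr_cder1 ud (nbhs_singleton wd)) _.
by apply: filterS wd => v vd; rewrite (cauchy r2r hd vd).
Qed.

(** Cauchy's formula passes to uniform limits, and whatever satisfies it is
    holomorphic. *)
Lemma hol_limit f c r : (forall e : R, 0 < e -> exists2 g, hol (disc c r) g &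
  forall z, disc c r z -> N (g z - f z) <= e) -> hol (disc c r) f.
Proof.
move=> lim z zr; have r0 : 0 < r := le_lt_trans (nc_ge0 _) zr.
have cf w : disc c r w -> ccont f w.
  move=> wr; split=> A /nbhsC[e e0 eA].
  have e3 : 0 < e / 3 by rewrite divr_gt0.
  have [g hg gf] := lim _ e3.
  have := ccontP (holo_cont (hg w wr)) (near_disc _ e3).
  apply: filterS2 (disc_nbhs wr) => v vr gv; apply: eA.
  have -> : f v - f w = (g v - g w) - (g v - f v) + (g w - f w) by ring.
  have h1 := gf v vr; have h2 := gf w wr.
  apply: le_lt_trans (ncD _ _) _; apply: le_lt_trans (lerD (ncB _ _) h2) _.
  by rewrite /= in gv; lra.
pose s := (N (z - c) + r) / 2; have zr' : N (z - c) < r by [].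
have zs : disc c s z by rewrite /disc /= /s; lra.
have sr : s < r by rewrite /s; lra.
have s0 : 0 < s by apply: le_lt_trans zs; exact: nc_ge0.
have ud : ucont (density f c s).
  by apply: ucont_density => u u1; apply: cf; exact: circle_disc.
apply: holo_near (ctr_hol1 ud zs) _.
apply: filterS (disc_nbhs zs) => w ws.
pose K := (pi *+ 2)^-1 * s / (s - N (w - c)).
have ws' : N (w - c) < s by [].
have K0 : 0 <= K.
  have i1 : 0 <= (pi *+ 2)^-1 :> R by rewrite invr_ge0 mulrn_wge0 // pi_ge0.
  have i2 : 0 <= (s - N (w - c))^-1 by rewrite invr_ge0 subr_ge0 ltW.
  by rewrite /K; do 2!apply: mulr_ge0 => //; exact: ltW.
suff main (e : R) : 0 < e -> N (ctr (density f c s) c s 1 w - f w) <=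
    (4 * pi * K + 1) * e.
  apply/eqP; rewrite -subr_eq0 -nc_eq0 eq_le nc_ge0 andbT.
  apply/ler_addgt0Pr => e e0; rewrite add0r.
  have K1 : 0 < 4 * pi * K + 1 
    by rewrite ltr_pwDr //; do 2!apply: mulr_ge0 => //; exact: pi_ge0.
  have := main (e / (4 * pi * K + 1)); rewrite divr_gt0 // => /(_ isT).
  by rewrite mulrC divfK // gt_eqF.
move=> e0; have [g hg gf] := lim _ e0.
have ug := hol_shrink sr hg s0.
have -> : ctr (density f c s) c s 1 w - f w =
    (ctr (density f c s) c s 1 w + (-1) * ctr (density g c s) c s 1 w) +
    (g w - f w) by rewrite -(cauchy sr hg ws); ring.
apply: le_trans (ncD _ _) _; rewrite mulrDl mul1r.
apply: lerD; last by apply: gf; rewrite /disc /=; apply: lt_trans sr.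
have uf' := @ucont_kernel _ c s w 1 ud ws.
have ug' := @ucont_kernel _ c s w 1 ug ws.
have ug2 : ucont (fun u => -1 * (density g c s u / (c + s%:C * u - w) ^+ 1)).
  by move=> u u1; apply: contM (cont_cst _ _) (ug' u u1).
rewrite /ctr -cintZ // -cintD // -mulrA; apply: cint_bound => [u u1|u u1].
  by apply: contD; [exact: uf'|exact: ug2].
rewrite expr1 (_ : _ + _ = - ((pi *+ 2)^-1)%:C * (s%:C * u) *
  (c + s%:C * u - w)^-1 * (g (c + s%:C * u) - f (c + s%:C * u))); last first.
  by rewrite /density; ring.
rewrite ncM; apply: ler_pM; rewrite ?nc_ge0 //; last first.
  by apply: gf; exact: circle_disc.
rewrite !ncM ncN ncV !ncR u1 mulr1 gtr0_norm ?invr_gt0; last first.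
  by rewrite pmulrn_lgt0 // pi_gt0.
rewrite gtr0_norm // /K; apply: ler_wpM2l.
  apply: mulr_ge0; last exact: ltW.
  by rewrite invr_ge0 mulrn_wge0 // pi_ge0.
have dl := circle_den c w u1 s0; have sw : 0 < s - N (w - c) by rewrite subr_gt0.
by rewrite lef_pV2 // posrE //; apply: lt_le_trans dl.
Qed.

(** From 1 / (zeta - w) = 1 / (zeta - c) + (w - c) / ((zeta - c) (zeta - w)): the
    quotient by w - c is the Cauchy transform of a new density. *)
Lemma ctr_step phi c r w : ucont phi -> disc c r w ->
  ctr phi c r 1 w = ctr phi c r 1 c +
    (w - c) * ctr (fun u => phi u * (r%:C * u)^-1) c r 1 w.
Proof.
move=> cphi wr; have r0 : 0 < r := le_lt_trans (nc_ge0 _) wr.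
have rC : r%:C != 0 :> C by rewrite -nc_eq0 ncR normr_eq0 gt_eqF.
have ru u : N u = 1 -> r%:C * u != 0.
  by move=> u1; rewrite mulf_neq0 // -nc_eq0 u1 oner_eq0.
have cpsi : ucont (fun u => phi u * (r%:C * u)^-1).
  move=> u u1; apply: contM; first exact: cphi.
  by apply: contV (ru u u1) (contM (cont_cst _ _) (cont_id _)).
have K1 := @ucont_kernel _ c r w 1 cpsi wr.
have K2 := @ucont_kernel _ c r c 1 cphi (disc_center c r0).
have K3 : ucont (fun u => (w - c) * (phi u / (r%:C * u) / (c + r%:C * u - w) ^+ 1)).
  by move=> u u1; apply: contM (cont_cst _ _) (K1 u u1).
rewrite /ctr -cintZ // -cintD //; apply: eq_cint => u u1.
have h1 := circle_den_neq0 u1 wr.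
have -> : c + r%:C * u - c = r%:C * u by ring.
rewrite !expr1; field; rewrite h1 rC /=.
by rewrite -nc_eq0 u1 oner_eq0.
Qed.

(** Division by powers of w - c is carried out on the density, so that no
    power series is needed: either the process stops at a quotient that does
    not vanish at the centre, or f is bounded by a multiple of (|w - c| / s)^m
    for all m, hence is zero on the disc of radius s. *)
Lemma holo_factor f c r : 0 < r -> hol (disc c r) f ->
  (exists2 s, 0 < s & forall w, disc c s w -> f w = 0) \/
  exists m s (u : C -> C), [/\ 0 < s, hol (disc c s) u &
    forall w, disc c s w -> u w != 0 /\ f w = (w - c) ^+ m * u w].
Proof.
move=> r0 hf; pose s := r / 2; have s0 : 0 < s by rewrite divr_gt0.
have sr : s < r by rewrite /s; lra.
have sC : s%:C != 0 :> C by rewrite -nc_eq0 ncR normr_eq0 gt_eqF.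
have ud := hol_shrink sr hf s0.
pose psi m u : C := density f c s u * ((s%:C * u)^-1) ^+ m.
have upsi m : ucont (psi m).
  elim: m => [|m IH].
    by rewrite /psi; under eq_fun do rewrite expr0 mulr1.
  rewrite /psi; under eq_fun do rewrite exprS mulrCA.
  move=> u u1; apply: contM (IH u u1).
  apply: contV; last by apply: contM (cont_cst _ _) (cont_id _).
  by rewrite mulf_neq0 // -nc_eq0 u1 oner_eq0.
pose h m := ctr (psi m) c s 1.
have step m w : disc c s w -> h m w = h m c + (w - c) * h m.+1 w.
  move=> ws; rewrite /h (ctr_step (upsi m) ws); congr (_ + _ * _).
  by rewrite /ctr; apply: eq_cint => u u1; rewrite /psi [in RHS]exprSr [in RHS]mulrA.
have h0 w : disc c s w -> f w = h 0%N w.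
  move=> ws; rewrite (cauchy sr hf ws); apply: eq_cint => u u1.
  by rewrite /psi expr0 mulr1.
have fh m w : (forall k, (k < m)%N -> h k c = 0) -> disc c s w ->
    f w = (w - c) ^+ m * h m w.
  move=> + ws; elim: m => [_|m IH hm]; first by rewrite expr0 mul1r h0.
  rewrite IH => [|k km]; last by apply: hm; exact: ltnW.
  by rewrite step // hm // add0r exprSr mulrA.
have [[m hm]|nh] := pselect (exists m, h m c != 0).
  right; have ex : exists m, h m c != 0 by exists m.
  have hmin k : (k < ex_minn ex)%N -> h k c = 0.
    case: ex_minnP => j _ jmin kj; apply/eqP; apply: contraTT kj => /jmin.
    by rewrite -leqNgt.
  have hn : h (ex_minn ex) c != 0 by case: ex_minnP.
  move: (ex_minn ex) hmin hn => j jmin hj {m hm ex}.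
  have hh : hol (disc c s) (h j) by exact: ctr_hol1.
  have := cont_neq0 (holo_cont (hh c (disc_center c s0))) hj.
  move=> /nbhsC[s1 s10 hs1].
  exists j, (Num.min s s1), (h j).
  have sub w : disc c (Num.min s s1) w -> disc c s w /\ N (w - c) < s1.
    by rewrite /disc /= lt_min => /andP[].
  split; first by rewrite lt_min s0.
    by move=> w /sub[/hh].
  by move=> w /sub[ws ws1]; split; [exact: hs1|exact: fh].
left; exists s => // w ws.
have hz m : h m c = 0.
  by apply/eqP; apply: contraPT isT => hm _; apply: nh; exists m.
have [M M0 dM] := circle_bounded ud.
have ws' : N (w - c) < s by [].
pose q := N (w - c) / s.
have q1 : `|q| < 1.
  by rewrite ger0_norm ?divr_ge0 ?nc_ge0 ?ltW // ltr_pdivrMr // mul1r.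
pose L := 4 * pi * (M / (s - N (w - c))).
have bound m : N (f w) <= L * q ^+ m.
  rewrite (fh m w (fun k _ => hz k) ws) ncM ncX.
  have -> : L * q ^+ m = N (w - c) ^+ m * (4 * pi *
      (M * (s^-1 ^+ m) * (s - N (w - c))^-1)).
    by rewrite /L /q exprMn; ring.
  apply: ler_wpM2l; first by rewrite exprn_ge0 ?nc_ge0.
  apply: cint_bound => [|u u1]; first exact: (@ucont_kernel _ c s w 1 (upsi m) ws).
  have dl := circle_den c w u1 s0; have sw : 0 < s - N (w - c) by rewrite subr_gt0.
  have si : 0 <= s^-1 ^+ m by rewrite exprn_ge0 // invr_ge0 ltW.
  rewrite /psi expr1 ncM ncV [N (density _ _ _ _ * _)]ncM ncX ncV.
  rewrite [N (s%:C * u)]ncM ncR u1 mulr1 gtr0_norm //.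
  apply: ler_pM.
  - by apply: mulr_ge0 => //; exact: nc_ge0.
  - by rewrite invr_ge0 nc_ge0.
  - by apply: ler_wpM2r => //; exact: dM.
  - by rewrite lef_pV2 // posrE //; apply: lt_le_trans dl.
have lim : (fun m => L * q ^+ m) @ \oo --> L * 0.
  by apply: cvgM; [exact: cvg_cst|exact: cvg_expr].
apply/eqP; rewrite -nc_eq0 eq_le nc_ge0 andbT.
rewrite mulr0 in lim; apply: (cvgr_to_ge lim).
by near=> m; exact: bound.
Unshelve. all: by end_near. Qed.

End Cauchy.

(** * The Cauchy-Riemann equations and the exponential function *)

Section CauchyRiemann.
Variable R : realType.
Local Notation C := (Cx R).
Local Notation N := (@Normc.normc R).
Implicit Types (z w c l : C) (f g : C -> C) (r : R).

Section Line.
Variable V : normedModType R.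
Implicit Types (p v : V) (u : V -> R).

Lemma is_derive_line u p v (t d : R) :
  is_derive (p + t *: v) v u d <-> is_derive t (1 : R) (fun s => u (p + s *: v)) d.
Proof.
have E : (fun h : R => h^-1 *: (u (h *: v + (p + t *: v)) - u (p + t *: v))) =
    (fun h : R => h^-1 *: ((fun s => u (p + s *: v)) (h *: (1 : R) + t) -
      (fun s => u (p + s *: v)) t)).
  apply/funext => h /=; congr (_ *: (u _ - _)).
  by rewrite scaler1 scalerDl addrCA.
split=> -[D <-]; split.
- by rewrite /derivable -E.
- by rewrite /derive -E.
- by rewrite /derivable E.
- by rewrite /derive E.
Qed.

Lemma line_mvt u p v (d : R -> R) (h : R) :
  (forall t, `|t| <= `|h| -> is_derive (p + t *: v) v u (d t)) ->
  exists2 c, `|c| <= `|h| & u (p + h *: v) - u p = d c * h.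
Proof.
move=> du; have du' t : `|t| <= `|h| ->
    is_derive t (1 : R) (fun s => u (p + s *: v)) (d t).
  by move=> /du /is_derive_line.
have [h0|h0] := lerP 0 h.
  have I t : t \in `[0, h]%R -> `|t| <= `|h|.
    by rewrite in_itv /= => /andP[t0 th]; rewrite !ger0_norm.
  have [|t|x xh e] := @MVT_segment R (fun s => u (p + s *: v)) d 0 h h0.
  - move=> t th; apply: du'; apply: I; exact: subset_itv_oo_cc th.
  - apply: continuous_in_subspaceT => s /set_mem /= sh.
    apply: differentiable_continuous; apply/derivable1_diffP.
    by case: (du' s (I s sh)).
  by exists x; [exact: I|move: e; rewrite scale0r addr0 subr0].
have I t : t \in `[h, 0]%R -> `|t| <= `|h|.
  rewrite in_itv /= => /andP[ht t0].
  by rewrite !ler0_norm // ?lerN2 // ltW.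
have [|t|x xh e] := @MVT_segment R (fun s => u (p + s *: v)) d h 0 (ltW h0).
- move=> t th; apply: du'; apply: I; exact: subset_itv_oo_cc th.
- apply: continuous_in_subspaceT => s /set_mem /= sh.
  apply: differentiable_continuous; apply/derivable1_diffP.
  by case: (du' s (I s sh)).
exists x; first exact: I.
by move: e; rewrite scale0r addr0 => e; rewrite -opprB e; ring.
Qed.

End Line.

Local Notation E1 := (@Defs.e1 R).
Local Notation E2 := (@Defs.e2 R).

Lemma scaleE1 (t : R) : t *: E1 = (t, 0).
Proof.
by apply/eqP; rewrite xpair_eqE /= [t *: 1]mulr1 [t *: 0]mulr0 !eqxx.
Qed.

Lemma scaleE2 (t : R) : t *: E2 = (0, t).
Proof.
by apply/eqP; rewrite xpair_eqE /= [t *: 1]mulr1 [t *: 0]mulr0 !eqxx.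
Qed.

(** The mean value theorem is applied on two sides of the rectangle with diagonal
    from p to p + (h, k). *)
Lemma C1_differential (u u1 u2 : R * R -> R) (p : R * R) :
  (\forall q \near p, is_derive q E1 u (u1 q) /\ is_derive q E2 u (u2 q)) ->
  {for p, continuous u1} -> {for p, continuous u2} ->
  forall e : R, 0 < e -> exists2 d : R, 0 < d & forall h k : R,
    `|h| < d -> `|k| < d ->
    `|u (p.1 + h, p.2 + k) - u p - (u1 p * h + u2 p * k)| <= e * (`|h| + `|k|).
Proof.
move=> du c1 c2 e e0.
move/cvgrPdist_lt : c1 => /(_ _ e0) c1; move/cvgrPdist_lt : c2 => /(_ _ e0) c2.
have [d /= d0 dP] : exists2 d : R, 0 < d & forall q : R * R, ball p d q ->
    [/\ is_derive q E1 u (u1 q), is_derive q E2 u (u2 q),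
      `|u1 p - u1 q| < e & `|u2 p - u2 q| < e].
  have H : \forall q \near p, [/\ is_derive q E1 u (u1 q),
      is_derive q E2 u (u2 q), `|u1 p - u1 q| < e & `|u2 p - u2 q| < e].
    by apply: filterS3 du c1 c2 => q [? ?] ? ?; split.
  have [d d0 dP] := (nbhs_ballP p _).1 H.
  by exists d.
exists d => // h k hd kd.
have B1 t : `|t| <= `|h| -> ball p d (p + t *: E1).
  move=> th; rewrite scaleE1; split; rewrite /ball /= opprD addrA subrr sub0r.
    by rewrite normrN; exact: le_lt_trans hd.
  by rewrite oppr0 normr0.
pose p' := p + h *: E1.
have B2 t : `|t| <= `|k| -> ball p d (p' + t *: E2).
  move=> tk; rewrite /p' scaleE1 scaleE2; split; rewrite /ball /=.
    by rewrite addr0 opprD addrA subrr sub0r normrN.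
  rewrite addr0 opprD addrA subrr sub0r normrN.
  exact: le_lt_trans kd.
have [|x xh ex] := @line_mvt _ u p E1 (fun t => u1 (p + t *: E1)) h.
  by move=> t /B1 /dP[].
have [|y yk ey] := @line_mvt _ u p' E2 (fun t => u2 (p' + t *: E2)) k.
  by move=> t /B2 /dP[].
have -> : (p.1 + h, p.2 + k) = p' + k *: E2.
  rewrite /p' scaleE1 scaleE2; case: (p) => a b.
  by apply/eqP; rewrite xpair_eqE /= !addr0 !eqxx.
have -> : u (p' + k *: E2) - u p - (u1 p * h + u2 p * k) =
    (u1 (p + x *: E1) - u1 p) * h + (u2 (p' + y *: E2) - u2 p) * k.
  rewrite -[u (p' + _)](subrK (u p')) ey -[u p' in X in X - u p](subrK (u p)) ex.
  by ring.
have [_ _ h1 _] := dP _ (B1 x xh); have [_ _ _ h2] := dP _ (B2 y yk).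
apply: le_trans (ler_normD _ _) _; rewrite !normrM mulrDr.
by apply: lerD; apply: ler_wpM2r => //; rewrite distrC ltW.
Qed.

Lemma cder_littleo f z l :
  (forall e : R, 0 < e -> exists2 d : R, 0 < d & forall w, N (w - z) < d ->
    N (f w - f z - l * (w - z)) <= e * N (w - z)) -> cder f z l.
Proof.
move=> fo; exists (fun w => if w == z then l else (f w - f z) / (w - z)).
split; first by rewrite eqxx.
  split=> A; rewrite eqxx => /nbhsC[e e0 eA].
  have e2 : 0 < e / 2 by rewrite divr_gt0.
  have [d d0 fd] := fo _ e2; apply/nbhsC; exists d => // w wd; apply: eA.
  case: (eqVneq w z) => [_|wz]; first by rewrite subrr nc0.
  have wz0 : w - z != 0 by rewrite subr_eq0.
  rewrite -(ltr_pM2r (x := N (w - z))) ?nc_gt0 // -ncM mulrBl divfK //.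
  apply: le_lt_trans (fd w wd) _; rewrite ltr_pM2r ?nc_gt0 //; lra.
near=> w; case: eqVneq => [->|wz]; first by rewrite subrr mulr0 addr0.
by rewrite divfK ?subr_eq0 // addrC subrK.
Unshelve. all: by end_near. Qed.

Lemma nbhs_toC (p : R * R) (A : set C) : nbhs (toC p) A ->
  nbhs p (@toC R @^-1` A).
Proof. exact: continuous_toC. Qed.

(** The hypothesis on the two partial derivatives is the system of Cauchy-Riemann
    equations, with a the common complex derivative. *)
Lemma cder_CR f (a : C -> C) (p : R * R) :
  (\forall q \near p, vder (fun q => f (toC q)) q E1 (a (toC q)) /\
    vder (fun q => f (toC q)) q E2 ('i%C * a (toC q))) ->
  ccont a (toC p) -> cder f (toC p) (a (toC p)).
Proof.
move=> df ca.
have cRe : {for p, continuous (fun q => complex.Re (a (toC q)))}.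
  move=> A /continuousRe /(ccontP ca); exact: nbhs_toC.
have cIm : {for p, continuous (fun q => complex.Im (a (toC q)))}.
  move=> A /continuousIm /(ccontP ca); exact: nbhs_toC.
have cNIm : {for p, continuous (fun q => - complex.Im (a (toC q)))}.
  by apply: continuousN; exact: cIm.
have iE (z : C) : 'i%C * z = - complex.Im z +i* complex.Re z.
  by case: z => x y; apply/eqP;
    rewrite eq_complex /= !(mul0r, mul1r) sub0r add0r !eqxx.
have dr : \forall q \near p,
    is_derive q E1 (fun q => complex.Re (f (toC q))) (complex.Re (a (toC q))) /\
    is_derive q E2 (fun q => complex.Re (f (toC q))) (- complex.Im (a (toC q))).
  by apply: filterS df => q [[d1 _] [d2 _]]; rewrite iE in d2; split.
have di : \forall q \near p,
    is_derive q E1 (fun q => complex.Im (f (toC q))) (complex.Im (a (toC q))) /\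
    is_derive q E2 (fun q => complex.Im (f (toC q))) (complex.Re (a (toC q))).
  by apply: filterS df => q [[_ d1] [_ d2]]; rewrite iE in d2; split.
apply: cder_littleo => e e0; have e4 : 0 < e / 4 by rewrite divr_gt0.
have [d1 d10 H1] := C1_differential dr cRe cNIm e4.
have [d2 d20 H2] := C1_differential di cIm cRe e4.
exists (Num.min d1 d2); first by rewrite lt_min d10.
move=> w; rewrite lt_min => /andP[w1 w2].
pose h := complex.Re (w - toC p); pose k := complex.Im (w - toC p).
have hN : `|h| <= N (w - toC p) := nc_Re _.
have kN : `|k| <= N (w - toC p) := nc_Im _.
have wE : toC (p.1 + h, p.2 + k) = w.
  rewrite /h /k; case: (w) => x y; case: (p) => s t.
  by apply/eqP; rewrite eq_complex /= ![_ + (_ - _)]addrC !subrK !eqxx.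
have := H1 h k (le_lt_trans hN w1) (le_lt_trans kN w1).
have := H2 h k (le_lt_trans hN w2) (le_lt_trans kN w2).
rewrite wE => Hi Hr; apply: le_trans (nc_le_ReIm _) _.
have -> : complex.Re (f w - f (toC p) - a (toC p) * (w - toC p)) =
    complex.Re (f w) - complex.Re (f (toC p)) -
    (complex.Re (a (toC p)) * h + - complex.Im (a (toC p)) * k).
  rewrite /h /k; case: (f w) (f (toC p)) (a (toC p)) (w - toC p) =>
    [x1 y1] [x2 y2] [x3 y3] [x4 y4] /=; ring.
have -> : complex.Im (f w - f (toC p) - a (toC p) * (w - toC p)) =
    complex.Im (f w) - complex.Im (f (toC p)) -
    (complex.Im (a (toC p)) * h + complex.Re (a (toC p)) * k).
  rewrite /h /k; case: (f w) (f (toC p)) (a (toC p)) (w - toC p) =>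
    [x1 y1] [x2 y2] [x3 y3] [x4 y4] /=; ring.
apply: le_trans (lerD Hr Hi) _.
have : e / 4 * (`|h| + `|k|) <= e / 4 * (N (w - toC p) + N (w - toC p)).
  by rewrite ler_wpM2l ?lerD // ltW.
lra.
Qed.

Lemma holo_CR f (a : C -> C) (p : R * R) :
  (\forall q \near p, vder (fun q => f (toC q)) q E1 (a (toC q)) /\
    vder (fun q => f (toC q)) q E2 ('i%C * a (toC q))) ->
  (\forall q \near p, ccont a (toC q)) -> holo_at f (toC p).
Proof.
move=> /near_join df ca; exists a; split; last exact: nbhs_singleton ca.
have H : \forall q \near p, cder f (toC q) (a (toC q)).
  by apply: filterS2 df ca => q; exact: cder_CR.
have : nbhs (ofC (toC p)) [set q | cder f (toC q) (a (toC q))] by rewrite toCK.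
move=> H'; have {}H' : nbhs (toC p) (fun w : C =>
  cder f (toC (ofC w)) (a (toC (ofC w)))) := @continuous_ofC R (toC p) _ H'.
by apply: filterS H' => w; rewrite ofCK.
Qed.

Lemma is_derive_line0 (V : normedModType R) (u : V -> R) p v (d : R) :
  is_derive p v u d <-> is_derive 0 (1 : R) (fun s => u (p + s *: v)) d.
Proof. by rewrite -is_derive_line scale0r addr0. Qed.

Lemma is_derive_affine (a b t : R) :
  is_derive t (1 : R) (fun s : R => a + s * b) b.
Proof.
apply: is_derive_eq.
by rewrite scaler0 !add0r mul1r [LHS]mulr1.
Qed.

Lemma vder_toC1 (p : R * R) : vder (@toC R) p E1 1.
Proof.
split; apply/is_derive_line0.
  exact: (is_derive_affine p.1 1 0).
exact: (is_derive_affine p.2 0 0).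
Qed.

Lemma vder_toC2 (p : R * R) : vder (@toC R) p E2 'i%C.
Proof.
split; apply/is_derive_line0.
  exact: (is_derive_affine p.1 0 0).
exact: (is_derive_affine p.2 1 0).
Qed.

Lemma vder_holo1 f (p : R * R) l : cder f (toC p) l ->
  vder (fun q => f (toC q)) p E1 l.
Proof. by move=> h; have := vder_comp (vder_toC1 p) h; rewrite mulr1. Qed.

Lemma vder_holo2 f (p : R * R) l : cder f (toC p) l ->
  vder (fun q => f (toC q)) p E2 ('i%C * l).
Proof. by move=> h; have := vder_comp (vder_toC2 p) h; rewrite mulrC. Qed.

Lemma vder_line0 (V : normedModType R) (g : V -> C) p v (d : C) :
  vder g p v d <-> vder (fun s : R => g (p + s *: v)) 0 (1 : R) d.
Proof.
have L u := is_derive_line0 u p v.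
split=> -[h1 h2]; split.
- exact: (L (fun q => complex.Re (g q)) _).1 h1.
- exact: (L (fun q => complex.Im (g q)) _).1 h2.
- exact: (L (fun q => complex.Re (g q)) _).2 h1.
- exact: (L (fun q => complex.Im (g q)) _).2 h2.
Qed.

End CauchyRiemann.

Section Exponential.
Variable R : realType.
Local Notation C := (Cx R).
Local Notation N := (@Normc.normc R).
Implicit Types (z w : C).
Local Notation E1 := (@Defs.e1 R).
Local Notation E2 := (@Defs.e2 R).

Definition cexp z : C := (expR (complex.Re z))%:C * cis (complex.Im z).

Lemma nc_cexp z : N (cexp z) = expR (complex.Re z).
Proof. by rewrite ncM nc_cis mulr1 ncR gtr0_norm // expR_gt0. Qed.

Lemma cexp_neq0 z : cexp z != 0.
Proof. by rewrite -nc_gt0 nc_cexp expR_gt0. Qed.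

Lemma cexp0 : cexp 0 = 1.
Proof.
rewrite /cexp /= expR0 mul1r /cis cos0 sin0.
by [].
Qed.

Lemma ccont_cexp z : ccont cexp z.
Proof.
split; apply: cvgM.
  move=> A /continuous_realC /continuous_expR; exact: continuousRe.
move=> A /continuous_cis; exact: continuousIm.
Qed.

Lemma cder_cexp z : cder cexp z (cexp z).
Proof.
rewrite -[z]ofCK; apply: cder_CR; last exact: ccont_cexp.
near=> q.
have EV : vder (fun q => cexp (toC q)) q E1 (cexp (toC q)).
  apply/vder_line0 => /=.
  have h1 : vder (fun s : R => (expR (q.1 + s * 1))%:C : C) 0 (1 : R)
      (expR q.1)%:C.
    split; last exact: is_derive_cst.
    have := @is_derive1_comp R (@expR R) (fun s => q.1 + s * 1) 0 _ _
      (is_derive_expR _) (is_derive_affine q.1 1 0).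
    by rewrite mul0r addr0 mulr1.
  have h2 : vder (fun s : R => cis (q.2 + s * 0)) 0 (1 : R) 0.
    by under eq_fun do rewrite mulr0; exact: vder_cst.
  have := vderM h1 h2; rewrite !mulr0 !addr0; exact.
split=> //; apply/vder_line0 => /=.
have h1 : vder (fun s : R => (expR (q.1 + s * 0))%:C : C) 0 (1 : R) 0.
  by under eq_fun do rewrite mulr0; exact: vder_cst.
have h2 : vder (fun s : R => cis (q.2 + s * 1)) 0 (1 : R) ('i%C * cis q.2).
  have -> : 'i%C * cis q.2 = - sin q.2 +i* cos q.2.
    by apply/eqP; rewrite eq_complex /= !(mul0r, mul1r) sub0r add0r !eqxx.
  split.
    have := @is_derive1_comp R (@cos R) (fun s => q.2 + s * 1) 0 _ _
      (is_derive_cos _) (is_derive_affine q.2 1 0).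
    by rewrite mul0r addr0 mulr1.
  have := @is_derive1_comp R (@sin R) (fun s => q.2 + s * 1) 0 _ _
      (is_derive_sin _) (is_derive_affine q.2 1 0).
  by rewrite mul0r addr0 mulr1.
have := vderM h1 h2; rewrite !mulr0 mul0r !addr0 add0r /cexp mulrCA; exact.
Unshelve. all: by end_near. Qed.

Lemma holo_cexp z : holo_at cexp z.
Proof.
exists cexp; split; last exact: ccont_cexp.
by near=> w; exact: cder_cexp.
Unshelve. all: by end_near. Qed.


(** The factor 2 comes from treating real and imaginary parts separately. *)
Lemma cder_mvt (f f' : C -> C) w (M : R) :
  (forall t : R, 0 <= t <= 1 -> cder f (t%:C * w) (f' (t%:C * w)) /\
    N (f' (t%:C * w)) <= M) ->
  N (f w - f 0) <= 2 * (M * N w).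
Proof.
move=> df.
have dg t : 0 <= t <= 1 ->
    vder (fun s : R => f (s%:C * w)) t (1 : R) (f' (t%:C * w) * w).
  move=> /df[d1 _]; have h := cderM (cder_id t%:C) (cder_cst w t%:C).
  rewrite mulr0 addr0 mul1r in h.
  by have := vder_comp (vder_real t) (cder_comp h d1); rewrite mulr1.
have bd t : 0 <= t <= 1 -> N (f' (t%:C * w) * w) <= M * N w.
  by move=> /df[_ h]; rewrite ncM ler_wpM2r ?nc_ge0.
have mvt (g d : R -> R) :
    (forall t : R, 0 <= t <= 1 -> is_derive t (1 : R) g (d t)) ->
    (forall t : R, 0 <= t <= 1 -> `|d t| <= M * N w) -> `|g 1 - g 0| <= M * N w.
  move=> gd dM.
  have [|t|x] := @MVT_segment R g d 0 1 ler01.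
  - by move=> t; rewrite in_itv /= => /andP[t0 t1]; apply: gd; rewrite !ltW.
  - apply: continuous_in_subspaceT => s /set_mem /=; rewrite in_itv /= => s01.
    apply: differentiable_continuous; apply/derivable1_diffP.
    by case: (gd s s01).
  by rewrite in_itv /= => x01 ->; rewrite subr0 mulr1; exact: dM.
have hr := mvt _ _ (fun t ht => (dg t ht).1)
  (fun t ht => le_trans (nc_Re _) (bd t ht)).
have hi := mvt _ _ (fun t ht => (dg t ht).2)
  (fun t ht => le_trans (nc_Im _) (bd t ht)).
rewrite !rmorph1 !rmorph0 !mul1r !mul0r in hr hi.
apply: le_trans (nc_le_ReIm _) _; rewrite mulrDl mul1r.
by move: (f w) (f 0) hr hi => [a b] [x y] /= hr hi; exact: lerD.
Qed.

(** The truncated series of - log (1 - w), the exponent in the elementary factors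
    of Weierstrass. *)
Definition wexp k w : C := \sum_(i < k) w ^+ i.+1 / i.+1%:R.

Lemma cder_exprn n w : cder (fun w => w ^+ n.+1) w (n.+1%:R * w ^+ n).
Proof.
elim: n => [|n IH].
  rewrite mul1r expr0; apply: cder_near (cder_id w) _.
  by near=> x; rewrite expr1.
have := cderM (cder_id w) IH.
rewrite (_ : _ + _ = n.+2%:R * w ^+ n.+1); last first.
  by rewrite -[n.+2%:R]natr1 exprS; ring.
move=> h; apply: cder_near h _; by near=> x; rewrite [RHS]exprS.
Unshelve. all: by end_near. Qed.

Lemma cder_wexp k w : cder (wexp k) w (\sum_(i < k) w ^+ i).
Proof.
elim: k => [|k IH].
  rewrite big_ord0; apply: cder_near (cder_cst 0 w) _.
  by near=> x; rewrite /wexp big_ord0.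
have h := cderM (cder_exprn k w) (cder_cst (k.+1%:R^-1) w).
have := cderD IH h; rewrite big_ord_recr /= mulr0 addr0.
rewrite mulrAC divff ?mul1r ?pnatr_eq0 // => h'; apply: cder_near h' _.
by near=> x; rewrite /wexp big_ord_recr.
Unshelve. all: by end_near. Qed.

Lemma holo_wexp k w : holo_at (wexp k) w.
Proof.
exists (fun w => \sum_(i < k) w ^+ i); split.
  by near=> x; exact: cder_wexp.
apply: holo_cont; apply: holo_sum => i; apply: holoX; exact: holo_id.
Unshelve. all: by end_near. Qed.

Lemma nc_wexp k w (q : R) : N w <= q -> q < 1 -> N (wexp k w) <= (1 - q)^-1.
Proof.
move=> wq q1; have q0 : 0 <= q := le_trans (nc_ge0 _) wq.
apply: le_trans (nc_sum _ _ _) _.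
apply: (@le_trans _ _ (\sum_(i < k) q ^+ i)).
  apply: ler_sum => i _; rewrite ncM ncX ncV.
  rewrite -(rmorph_nat (real_complex R)) ncR normr_nat.
  have w1 : N w <= 1 by apply: le_trans wq _; exact: ltW.
  apply: (@le_trans _ _ (N w ^+ i)).
    rewrite ler_pdivrMr ?ltr0n //; apply: (@le_trans _ _ (N w ^+ i)).
      by rewrite exprS ler_piMl ?exprn_ge0 ?nc_ge0.
    by rewrite ler_peMr ?exprn_ge0 ?nc_ge0 // ler1n.
  by rewrite lerXn2r ?nnegrE ?nc_ge0.
have h : (1 - q) * (\sum_(i < k) q ^+ i) = 1 - q ^+ k.
  by rewrite -[RHS]opprB subrX1 -mulNr opprB.
rewrite -(ler_pM2l (x := 1 - q)) ?subr_gt0 // h divff ?gt_eqF ?subr_gt0 //.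
by rewrite gerBl exprn_ge0.
Qed.

(** Elementary factors of Weierstrass: (1 - w) exp (w + ... + w^k / k) is 1 at 0 and
    has the derivative - w^k exp (w + ... + w^k / k), which is uniformly small
    on the disc of radius q for large k. *)
Lemma elementary_factor (q e : R) : q < 1 -> 0 < e ->
  exists h : C -> C, [/\ forall w, holo_at h w, forall w, h w != 0 &
    forall w, N w <= q -> N ((1 - w) * h w - 1) <= e].
Proof.
move=> q1 e0.
have [q0|q0] := ltP q 0.
  exists (fun=> 1); split=> [w|w|w wq]; first exact: holo_cst.
    exact: oner_neq0.
  by have := le_lt_trans wq q0; rewrite ltNge nc_ge0.
pose M := expR (1 - q)^-1.
have [k kP] : exists k, 2 * (q ^+ k * M * q) <= e.
  have lim : (fun k => 2 * (M * q) * q ^+ k) @ \oo --> 2 * (M * q) * 0.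
    by apply: cvgM; [exact: cvg_cst|apply: cvg_expr; rewrite ger0_norm].
  rewrite mulr0 in lim; move/cvgrPdist_le : lim => /(_ e e0)[k _ /(_ k (leqnn k))].
  rewrite /= sub0r normrN => h; exists k; apply: le_trans h.
  by apply: le_trans (ler_norm _); rewrite le_eqVlt; apply/orP; left; apply/eqP; ring.
exists (fun w => cexp (wexp k w)); split=> [w|w|w wq].
- by apply: holo_comp; [exact: holo_wexp|exact: holo_cexp].
- exact: cexp_neq0.
pose E w : C := (1 - w) * cexp (wexp k w).
pose E' w : C := - (w ^+ k) * cexp (wexp k w).
have dE x : cder E x (E' x).
  have h1 := cderB (cder_cst 1 x) (cder_id x).
  have h2 := cder_comp (cder_wexp k x) (cder_cexp (wexp k x)).
  rewrite (_ : E' x = (0 - 1) * cexp (wexp k x) +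
    (1 - x) * (cexp (wexp k x) * (\sum_(i < k) x ^+ i))); first exact: cderM h1 h2.
  have h : (1 - x) * (\sum_(i < k) x ^+ i) = 1 - x ^+ k.
    by rewrite -[RHS]opprB subrX1 -mulNr opprB.
  by rewrite [X in _ + X]mulrCA h /E'; ring.
have E0 : E 0 = 1.
  rewrite /E subr0 mul1r (_ : wexp k 0 = 0) ?cexp0 //.
  by rewrite /wexp big1 // => i _; rewrite expr0n mul0r.
rewrite -[in X in N (_ - X)]E0; apply: le_trans kP.
apply: le_trans (cder_mvt (f := E) (f' := E') (M := q ^+ k * M) _) _.
  move=> t /andP[t0 t1]; split; first exact: dE.
  have tq : N (t%:C * w) <= q.
    rewrite ncM ncR ger0_norm //; apply: le_trans wq.
    by rewrite ler_piMl ?nc_ge0.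
  rewrite ncM ncN ncX; apply: ler_pM; rewrite ?exprn_ge0 ?nc_ge0 //.
    by rewrite lerXn2r ?nnegrE ?nc_ge0.
  rewrite nc_cexp ler_expR; apply: le_trans (ler_norm _) _.
  by apply: le_trans (nc_Re _) _; exact: nc_wexp.
rewrite ler_pM2l // ler_wpM2l // mulr_ge0 ?exprn_ge0 //.
by rewrite /M ltW // expR_gt0.
Qed.

End Exponential.

(** * Weierstrass products *)

Section Weierstrass.
Variable R : realType.
Local Notation C := (Cx R).
Local Notation N := (@Normc.normc R).
Implicit Types (z w a b p : C).

Lemma seq_complete (a : nat -> C) (j : nat) (c : R) :
  (forall n k, (j <= k <= n)%N -> N (a n - a k) <= c * 2^-1 ^+ k) ->
  exists l, forall k, (j <= k)%N -> N (a k - l) <= 2 * c * 2^-1 ^+ k.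
Proof.
move=> ca.
have real_lim (b : nat -> R) :
    (forall n k, (j <= k <= n)%N -> `|b n - b k| <= c * 2^-1 ^+ k) ->
    exists l, forall k, (j <= k)%N -> `|b k - l| <= c * 2^-1 ^+ k.
  move=> cb.
  have lim : (fun k => c * 2^-1 ^+ k) @ \oo --> c * 0.
    apply: cvgM; [exact: cvg_cst|apply: cvg_expr].
    by rewrite ger0_norm ?invr_ge0 // invf_lt1 // ltr1n.
  rewrite mulr0 in lim.
  have /cvg_ex[l bl] : cvg (b @ \oo).
    apply: cauchy_cvg; apply: cauchy_exP => e e0.
    move/cvgrPdist_lt : lim => /(_ e e0)[k _ kP].
    exists (b (maxn j k)); exists (maxn j k) => // n /= kn.
    rewrite /ball /= distrC; apply: le_lt_trans (cb n (maxn j k) _) _.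
      by rewrite leq_maxl.
    have := kP (maxn j k) (leq_maxr _ _); rewrite /= sub0r normrN.
    exact: le_lt_trans (ler_norm _).
  exists l => k jk.
  have h : (fun n => `|b k - b n|) @ \oo --> `|b k - l|.
    by apply: cvg_norm; apply: cvgB; [exact: cvg_cst|exact: bl].
  apply: (cvgr_to_le h); exists k => // n /= kn.
  by rewrite distrC cb // jk.
have [|x xP] := real_lim (fun n => complex.Re (a n)).
  move=> n k /ca; apply: le_trans; apply: le_trans (nc_Re _).
  by case: (a n) (a k) => [? ?] [? ?].
have [|y yP] := real_lim (fun n => complex.Im (a n)).
  move=> n k /ca; apply: le_trans; apply: le_trans (nc_Im _).
  by case: (a n) (a k) => [? ?] [? ?].
exists (x +i* y) => k jk; apply: le_trans (nc_le_ReIm _) _.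
rewrite -mulrA mulrDl mul1r; apply: le_trans (lerD (xP k jk) (yP k jk)).
by case: (a k) => s t /=.
Qed.

(** Pointwise convergence in terms of the real-valued norm, to define the product
    on Omega independently of the compact set used to estimate it. *)
Definition seqlim (a : nat -> C) (l : C) :=
  forall e : R, 0 < e -> exists n0, forall n, (n0 <= n)%N -> N (a n - l) <= e.

Lemma seqlim_unique (a : nat -> C) l1 l2 : seqlim a l1 -> seqlim a l2 -> l1 = l2.
Proof.
move=> h1 h2; apply/eqP; rewrite -subr_eq0 -nc_eq0 eq_le nc_ge0 andbT.
apply/ler_addgt0Pr => e e0; rewrite add0r.
have e2 : 0 < e / 2 by rewrite divr_gt0.
have [n1 H1] := h1 _ e2; have [n2 H2] := h2 _ e2.
have := H1 (maxn n1 n2) (leq_maxl _ _); have := H2 (maxn n1 n2) (leq_maxr _ _).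
set x := a _ => q2 q1; have -> : l1 - l2 = (x - l2) - (x - l1) by ring.
by apply: le_trans (ncB _ _) _; lra.
Qed.

Variable Omega : set C.
Hypothesis openO : forall z, Omega z -> exists2 r : R, 0 < r & disc z r `<=` Omega.

Definition Kset (n : nat) : set C :=
  [set z | N z <= n.+1%:R /\ forall b, ~ Omega b -> n.+1%:R^-1 <= N (z - b)].

(** Exhaustion of Omega by compact sets; it starts with the empty set, so that the
    zeros in the first nonempty set form a layer like the others. *)
Definition Kex (n : nat) : set C := if n is n'.+1 then Kset n' else set0.

Lemma Kset_sub n z : Kset n z -> Omega z.
Proof.
move=> [_ zb]; apply: contrapT => /zb; rewrite subrr nc0.
by rewrite leNgt invr_gt0 ltr0n.
Qed.

Lemma Kex_sub n z : Kex n z -> Omega z.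
Proof. by case: n => // n; exact: Kset_sub. Qed.

Lemma Kex_mono n k z : (n <= k)%N -> Kex n z -> Kex k z.
Proof.
case: n k => [|n] [|k] //; rewrite ltnS => nk [zn zb]; split.
  by apply: le_trans zn _; rewrite ler_nat.
move=> b /zb; apply: le_trans.
by rewrite lef_pV2 ?posrE ?ltr0n // ler_nat.
Qed.

Lemma Kex_interior z : Omega z -> exists2 r : R, 0 < r &
  exists n, disc z r `<=` Kex n.
Proof.
move=> /openO[r0 r00 zO]; have r2 : 0 < r0 / 2 by rewrite divr_gt0.
exists (r0 / 2) => //.
pose n := Num.bound (N z + r0 / 2 + (r0 / 2)^-1).
have i0 : 0 < (r0 / 2)^-1 by rewrite invr_gt0.
have nP : N z + r0 / 2 + (r0 / 2)^-1 < n.+1%:R.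
  apply: (@lt_trans _ _ n%:R); last by rewrite ltr_nat.
  by rewrite /n; apply: archi_boundP; rewrite !addr_ge0 ?nc_ge0 // ltW.
have z0 := nc_ge0 z.
exists n.+1 => w wz; have wz' : N (w - z) < r0 / 2 by [].
split.
  have : N w <= N (w - z) + N z by rewrite -{1}(subrK z w); exact: ncD.
  lra.
move=> b nb; apply: (@le_trans _ _ (r0 / 2)).
  rewrite -[leRHS]invrK lef_pV2 ?posrE ?ltr0n // ?invr_gt0 //; lra.
have zb : r0 <= N (z - b).
  by rewrite leNgt; apply/negP => h; apply: nb; apply: zO; rewrite /disc /= ncBC.
have : N (z - b) <= N (w - b) + N (w - z).
  by rewrite (_ : z - b = (w - b) - (w - z)); [exact: ncB|ring].
lra.
Qed.

Lemma compact_Kset n : compact (Kset n).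
Proof.
apply: (subclosed_compact _ (@compact_cdisc R 0 n.+1%:R)).
  have -> : Kset n = (fun z => N z) @^-1` [set x | x <= n.+1%:R] `&`
      \bigcap_(b in ~` Omega) ((fun z => N (z - b)) @^-1` [set x | n.+1%:R^-1 <= x]).
    by [].
  apply: closedI.
    by apply: closed_comp; [move=> z _; exact: continuous_nc|exact: closed_le].
  apply: closed_bigI => b _; apply: closed_comp; last exact: closed_ge.
  by move=> z _; exact: continuous_ncB.
by move=> z [zn _]; rewrite /= subr0.
Qed.

(** One zero at a point a outside a compact set of the exhaustion can be created
    by a factor close to 1 on that set: the elementary factor is taken at z / a
    when a is large, and at (a - b) / (z - b) when a is close to a point b of
    the complement. *)
Lemma near1_factor n a (e : R) : Omega a -> ~ Kex n a -> 0 < e ->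
  exists h : C -> C, [/\ hol Omega h, forall z, Omega z -> h z != 0 &
    forall z, Kex n z -> N ((z - a) * h z - 1) <= e].
Proof.
case: n => [_ _ _|n aO naK e0].
  exists (fun=> 1); split=> // z _; exact: holo_cst.
have n0 : 0 < n.+1%:R :> R by rewrite ltr0n.
have [an|an] := leP (N a) n.+1%:R; last first.
  have Na : 0 < N a := lt_trans n0 an.
  have a0 : a != 0 by rewrite -nc_gt0.
  have q1 : n.+1%:R / N a < 1 by rewrite ltr_pdivrMr // mul1r.
  have [h [hh h0 hP]] := elementary_factor q1 e0.
  exists (fun z => - a^-1 * h (a^-1 * z)); split=> [z zO|z zO|z [zn _]].
  - apply: holoM (holo_cst _ _) _; apply: holo_comp (hh _).
    by apply: holoM (holo_cst _ _) (holo_id _).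
  - by rewrite mulf_neq0 // oppr_eq0 invr_eq0.
  rewrite (_ : (z - a) * _ = (1 - a^-1 * z) * h (a^-1 * z)); last by field.
  by apply: hP; rewrite ncM ncV mulrC ler_pM2r ?invr_gt0.
have [b nb ab] : exists2 b, ~ Omega b & N (a - b) < n.+1%:R^-1.
  apply: contrapT => nh; apply: naK; split=> // b nb.
  by rewrite leNgt; apply/negP => abn; apply: nh; exists b.
have q1 : N (a - b) * n.+1%:R < 1 by rewrite -ltr_pdivlMr // mul1r.
have [h [hh h0 hP]] := elementary_factor q1 e0.
have zb z : Omega z -> z - b != 0.
  by move=> zO; rewrite subr_eq0; apply: contraPneq zO => ->.
exists (fun z => (z - b)^-1 * h ((a - b) * (z - b)^-1)).
have hi z : Omega z -> holo_at (fun z => (z - b)^-1) z.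
  move=> zO; apply: (holoV (f := fun z => z - b) (zb z zO)).
  exact: holoB (holo_id _) (holo_cst _ _).
split=> [z zO|z zO|z zK].
- apply: holoM (hi z zO) _; apply: holo_comp (hh _).
  exact: holoM (holo_cst _ _) (hi z zO).
- by rewrite mulf_neq0 ?invr_eq0 ?zb.
have zO := Kset_sub zK; case: zK => _ /(_ b nb) zK.
rewrite (_ : (z - a) * _ = (1 - (a - b) / (z - b)) * h ((a - b) / (z - b))).
  apply: hP; rewrite ncM ncV; apply: ler_wpM2l; first exact: nc_ge0.
  by rewrite -[leRHS]invrK lef_pV2 // posrE ?nc_gt0 ?zb // invr_gt0.
by field; exact: zb.
Qed.

Variable m : C -> nat.
Hypothesis discrete_m : forall p, Omega p -> exists2 r : R, 0 < r &
  forall z, disc p r z -> z <> p -> m z = 0%N.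

(** The constant e / 3 absorbs the product of two errors and their sum. *)
Lemma near1_product n (s : seq C) (e : R) :
  (forall a, a \in s -> Omega a /\ ~ Kex n a) -> 0 < e ->
  exists h : C -> C, [/\ hol Omega h, forall z, Omega z -> h z != 0 &
    forall z, Kex n z -> N ((\prod_(a <- s) (z - a)) * h z - 1) <= e].
Proof.
elim: s e => [|a s IH] e sK e0.
  exists (fun=> 1); split=> z zO; first exact: holo_cst.
    exact: oner_neq0.
  by rewrite big_nil mulr1 subrr nc0 ltW.
pose d := Num.min 1 (e / 3).
have d0 : 0 < d by rewrite lt_min ltr01 divr_gt0.
have d1 : d <= 1 by rewrite ge_min lexx.
have d2 : d <= e / 3 by rewrite ge_min lexx orbT.
have [h [hh h0 hP]] := IH d (fun b bs => sK b (mem_behead (s := a :: s) bs)) d0.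
have [aO aK] := sK a (mem_head _ _).
have [k [kh k0 kP]] := near1_factor aO aK d0.
exists (fun z => k z * h z); split=> z zO.
- exact: holoM (kh z zO) (hh z zO).
- by rewrite mulf_neq0 ?k0 ?h0.
rewrite big_cons; set P := \prod_(_ <- _) _.
have -> : (z - a) * P * (k z * h z) - 1 =
  ((z - a) * k z - 1) * (P * h z - 1) + (((z - a) * k z - 1) + (P * h z - 1)).
  by ring.
have h1 := kP z zO; have h2 := hP z zO; rewrite -/P in h2.
apply: le_trans (ncD _ _) _; rewrite ncM.
have h3 := le_trans (ncD _ _) (lerD h1 h2).
have h4 : N ((z - a) * k z - 1) * N (P * h z - 1) <= 1 * d.
  by apply: ler_pM; rewrite ?nc_ge0 //; exact: le_trans h1 d1.
by apply: le_trans (lerD h4 h3) _; lra.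
Qed.

(** By compactness, since m is zero on punctured neighbourhoods. *)
Lemma zeros_Kset n : exists s : seq C, forall a, Kset n a -> m a <> 0%N -> a \in s.
Proof.
have [r rP] : {r : C -> R & forall p, Omega p -> 0 < r p /\
    forall z, disc p (r p) z -> z <> p -> m z = 0%N}.
  apply: (@choice C R (fun p r => Omega p -> 0 < r /\
    forall z, disc p r z -> z <> p -> m z = 0%N)) => p.
  have [/discrete_m[r r0 rP]|np] := pselect (Omega p); first by exists r.
  by exists 0.
have := @compact_Kset n; rewrite compact_cover => cK.
have [|z zK|D DK DC] := cK C (Kset n) (fun p => disc p (r p)).
- move=> p pK; rewrite openE => z; exact: disc_nbhs.
- by exists z => //; apply: disc_center; case: (rP z (Kset_sub zK)).
exists (enum_fset D) => a aK ma.
have [p pD ap] := DC a aK.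
have pK : Kset n p by apply/set_mem; exact: DK.
have [_ h] := rP p (Kset_sub pK).
have [<-//|/eqP pa] := eqVneq p a.
by case: ma; apply: h ap _ => // e; apply: pa.
Qed.

Lemma zeros_layer n : exists s : seq C, uniq s /\
  forall a, a \in s <-> [/\ Kex n.+1 a, ~ Kex n a & m a <> 0%N].
Proof.
have [s sP] := zeros_Kset n.
exists [seq a <- undup s | `[< [/\ Kex n.+1 a, ~ Kex n a & m a <> 0%N] >]].
split; first by rewrite filter_uniq // undup_uniq.
move=> a; rewrite mem_filter mem_undup; split=> [/andP[/asboolP]//|h].
by apply/andP; split; [exact/asboolP|case: h => aK _ ma; exact: sP].
Qed.

(** Layers of the product: finitely many zeros with their multiplicities,
    and a nonvanishing factor making the layer close to 1. *)
Lemma layers : exists (s : nat -> seq C) (h : nat -> C -> C), forall n,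
  [/\ uniq (s n),
    forall a, a \in s n <-> [/\ Kex n.+1 a, ~ Kex n a & m a <> 0%N],
    hol Omega (h n), forall z, Omega z -> h n z != 0 &
    forall z, Kex n z ->
      N ((\prod_(a <- s n) (z - a) ^+ m a) * h n z - 1) <= 2^-1 ^+ n / 32].
Proof.
have [s sP] := choice zeros_layer.
have e0 n : 0 < 2^-1 ^+ n / 32 :> R by rewrite divr_gt0 // exprn_gt0.
have H n : exists h : C -> C, [/\ hol Omega h, forall z, Omega z -> h z != 0 &
    forall z, Kex n z ->
      N ((\prod_(a <- flatten [seq nseq (m a) a | a <- s n]) (z - a)) * h z - 1)
        <= 2^-1 ^+ n / 32].
  apply: near1_product (e0 n) => a /flattenP[t /mapP[b bs ->]].
  rewrite mem_nseq => /andP[_ /eqP ->].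
  by have [_ /(_ b)[/(_ bs)[bK nbK _] _]] := sP n; split => //; exact: Kex_sub bK.
have [h hP] := choice H; exists s, h => n.
have [us ms] := sP n; have [hh h0 hn] := hP n; split=> // z /hn.
congr (N (_ * _ - 1) <= _); rewrite big_flatten big_map; apply: eq_bigr => a _.
by rewrite big_nseq -Monoid.iteropE.
Qed.


(** Weierstrass's theorem. With g n the n-th layer, which differs from 1 by at most
    2^-n / 32 on Kex n, the partial products T j n starting at j converge
    uniformly on Kex j to a limit L j close to 1, hence without zeros. There
    the full product is the finite product T 0 j times L j, so its zeros are
    those of the first j layers. *)
Lemma weierstrass : exists F : C -> C, forall p, Omega p ->
  exists (r : R) (v : C -> C), [/\ 0 < r, hol (disc p r) v &
    forall z, disc p r z -> v z != 0 /\ F z = (z - p) ^+ m p * v z].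
Proof.
have [s [h sh]] := layers.
pose g n z : C := (\prod_(a <- s n) (z - a) ^+ m a) * h n z.
have us n : uniq (s n) by case: (sh n).
have ms n a : a \in s n <-> [/\ Kex n.+1 a, ~ Kex n a & m a <> 0%N].
  by case: (sh n).
have hh n : hol Omega (h n) by case: (sh n).
have h0 n z : Omega z -> h n z != 0 by case: (sh n) => _ _ _ + _; exact.
have g1 n z : Kex n z -> N (g n z - 1) <= 2^-1 ^+ n / 32.
  by case: (sh n) => _ _ _ _; exact.
have hg n : hol Omega (g n).
  move=> z zO; apply: holoM (hh n z zO).
  elim: (s n) => [|a t IH].
    by under eq_fun do rewrite big_nil; exact: holo_cst.
  under eq_fun do rewrite big_cons; apply: holoM IH.
  by apply: holoX; exact: holoB (holo_id _) (holo_cst _ _).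
pose T j n z : C := \prod_(j <= k < n) g k z.
have TS j n z : (j <= n)%N -> T j n.+1 z = T j n z * g n z.
  by move=> jn; rewrite /T big_nat_recr.
have hT j n : hol Omega (T j n).
  move=> z zO; have [jn|/ltnW nj] := leqP j n; last first.
    by rewrite /T; under eq_fun do rewrite big_geq //; exact: holo_cst.
  elim: n jn => [|n IH].
    rewrite leqn0 => /eqP ->.
    by rewrite /T; under eq_fun do rewrite big_geq //; exact: holo_cst.
  rewrite leq_eqVlt => /predU1P[->|].
    by rewrite /T; under eq_fun do rewrite big_geq //; exact: holo_cst.
  rewrite ltnS => jn; apply: holo_near (holoM (IH jn) (hg n z zO)) _.
  by near=> w; rewrite TS.
have half n : 0 <= 2^-1 ^+ n :> R by rewrite exprn_ge0.
have halfS n : 2^-1 ^+ n.+1 = 2^-1 ^+ n / 2 :> R by rewrite exprSr.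
have T1 j n z : (j <= n)%N -> Kex j z ->
    N (T j n z - 1) <= (2^-1 ^+ j - 2^-1 ^+ n) / 8.
  move=> + zK; elim: n => [|n IH].
    by rewrite leqn0 => /eqP ->; rewrite /T big_geq // !subrr nc0 mul0r.
  rewrite leq_eqVlt => /predU1P[->|].
    by rewrite /T big_geq // !subrr nc0 mul0r.
  rewrite ltnS => jn; rewrite TS //.
  have zn := Kex_mono jn zK; have b1 := g1 n z zn; have b2 := IH jn.
  have -> : T j n z * g n z - 1 =
    (T j n z - 1) * (g n z - 1) + ((T j n z - 1) + (g n z - 1)) by ring.
  apply: le_trans (ncD _ _) _; rewrite ncM.
  have b3 := le_trans (ncD _ _) (lerD b2 b1).
  have j1 : 2^-1 ^+ j <= 1 :> R by rewrite exprn_ile1 // invf_le1 // ler1n.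
  have b5 : N (T j n z - 1) <= 1 by have := half n; lra.
  have b4 : N (T j n z - 1) * N (g n z - 1) <= 1 * (2^-1 ^+ n / 32).
    by apply: ler_pM; rewrite ?nc_ge0.
  by apply: le_trans (lerD b4 b3) _; rewrite halfS; have := half n; lra.
have Tcauchy j z n k : Kex j z -> (j <= k <= n)%N ->
    N (T j n z - T j k z) <= 8^-1 * 2^-1 ^+ k.
  move=> zK /andP[jk kn].
  suff : N (T j n z - T j k z) <= (2^-1 ^+ k - 2^-1 ^+ n) / 8.
    by have := half n; have := half k; lra.
  elim: n kn => [|n IH].
    by rewrite leqn0 => /eqP ->; rewrite !subrr nc0 mul0r.
  rewrite leq_eqVlt => /predU1P[->|]; first by rewrite !subrr nc0 mul0r.
  rewrite ltnS => kn; have jn := leq_trans jk kn; rewrite TS //.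
  have zn := Kex_mono jn zK; have b1 := g1 n z zn; have b2 := IH kn.
  have b3 := T1 j n z jn zK.
  have -> : T j n z * g n z - T j k z =
    T j n z * (g n z - 1) + (T j n z - T j k z) by ring.
  apply: le_trans (ncD _ _) _; rewrite ncM.
  have j1 : 2^-1 ^+ j <= 1 :> R by rewrite exprn_ile1 // invf_le1 // ler1n.
  have b5 : N (T j n z) <= 2.
    have : N (T j n z) <= N (T j n z - 1) + N (1 : C).
      by rewrite -{1}(subrK 1 (T j n z)); exact: ncD.
    by rewrite nc1; have := half n; lra.
  have b4 : N (T j n z) * N (g n z - 1) <= 2 * (2^-1 ^+ n / 32).
    by apply: ler_pM; rewrite ?nc_ge0.
  by apply: le_trans (lerD b4 b2) _; rewrite halfS; have := half n; lra.
have Tlim j z : exists l, Kex j z ->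
    forall k, (j <= k)%N -> N (T j k z - l) <= 2 * 8^-1 * 2^-1 ^+ k.
  have [zK|nzK] := pselect (Kex j z); last by exists 0.
  have [|l lP] := @seq_complete (fun n => T j n z) j 8^-1.
    by move=> n k; exact: Tcauchy.
  by exists l.
have [L LP] : {L : nat -> C -> C & forall j z, Kex j z ->
    forall k, (j <= k)%N -> N (T j k z - L j z) <= 2 * 8^-1 * 2^-1 ^+ k}.
  have [L LP] := choice (fun jz : nat * C => Tlim jz.1 jz.2).
  by exists (fun j z => L (j, z)) => j z; exact: (LP (j, z)).
pose F z : C := xget 0 [set l | seqlim (fun n => T 0%N n z) l].
have FE j z : Kex j z -> F z = T 0%N j z * L j z.
  move=> zK.
  have lim : seqlim (fun n => T 0%N n z) (T 0%N j z * L j z).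
    move=> e e0; pose B := N (T 0%N j z) + 1.
    have B0 : 0 < B by rewrite ltr_pwDr ?nc_ge0.
    have cv : (fun k => B * 2^-1 ^+ k) @ \oo --> B * 0.
      apply: cvgM; [exact: cvg_cst|apply: cvg_expr].
      by rewrite ger0_norm ?invr_ge0 // invf_lt1 // ltr1n.
    rewrite mulr0 in cv; move/cvgrPdist_le : cv => /(_ e e0)[k0 _ kP].
    exists (maxn j k0) => n; rewrite geq_max => /andP[jn kn].
    have -> : T 0%N n z = T 0%N j z * T j n z.
      by rewrite /T -big_cat_nat.
    rewrite -mulrBr ncM.
    have b1 := LP j z zK n jn; have b2 := kP n kn.
    rewrite sub0r normrN in b2; have b3 := le_trans (ler_norm _) b2.
    apply: le_trans b3; apply: ler_pM; rewrite ?nc_ge0 // ?lerDl //.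
    by apply: le_trans b1 _; have := half n; lra.
  rewrite /F; case: xgetP => [l -> /= fl|/(_ _ lim)] //.
  exact: seqlim_unique fl lim.
exists F => p pO.
have [r1 r10 [j r1K]] := Kex_interior pO.
have [r2 r20 r2m] := discrete_m pO.
pose r := Num.min r1 r2.
have sub z : disc p r z -> disc p r1 z /\ disc p r2 z.
  by rewrite /disc /= lt_min => /andP.
have r0 : 0 < r by rewrite lt_min r10.
have zK z : disc p r z -> Kex j z by move=> /sub[/r1K].
(* the zeros in Kex j, each listed once *)
pose Z := flatten [seq s k | k <- iota 0 j].
have mZ a : a \in Z <-> Kex j a /\ m a <> 0%N.
  rewrite /Z; elim: (j) => [|i IH]; first by split=> // -[].
  rewrite -[i.+1]addn1 iotaD map_cat flatten_cat /= cats0 mem_cat add0n.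
  split=> [/orP[/IH[aK ma]|/ms[aK _ ma]]|[aK ma]].
  - by split=> //; rewrite addn1; apply: Kex_mono aK.
  - by rewrite addn1.
  have [aK'|naK] := pselect (Kex i a).
    by apply/orP; left; apply/IH.
  by apply/orP; right; apply/ms; rewrite -addn1.
have uZ : uniq Z.
  rewrite /Z; have : forall i, (i <= j)%N -> uniq (flatten [seq s k | k <- iota 0 i]) /\
      forall a, a \in flatten [seq s k | k <- iota 0 i] -> Kex i a.
    elim=> [//|i IH] ij; have [u1 k1] := IH (ltnW ij).
    rewrite -[i.+1]addn1 iotaD map_cat flatten_cat /= cats0 add0n; split.
      rewrite cat_uniq u1 us andbT /=; apply/hasPn => a /ms[_ naK _].
      by apply/negP => /k1.
    move=> a; rewrite mem_cat addn1 => /orP[/k1|/ms[]//].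
    exact: Kex_mono.
  by move=> /(_ j (leqnn j))[].
have TZ z : T 0%N j z = (\prod_(a <- Z) (z - a) ^+ m a) * \prod_(0 <= k < j) h k z.
  rewrite /T /g big_split /= /Z big_flatten big_map /=; congr (_ * _).
  by rewrite /index_iota subn0.
pose Q z : C := \prod_(a <- Z | a != p) (z - a) ^+ m a.
have ZQ z : \prod_(a <- Z) (z - a) ^+ m a = (z - p) ^+ m p * Q z.
  have [pZ|pZ] := boolP (p \in Z); first by rewrite (bigD1_seq p).
  have -> : m p = 0%N.
    apply: contrapT => mp; move/negP: pZ; apply; apply/mZ; split=> //.
    by apply: zK; exact: disc_center.
  rewrite expr0 mul1r /Q big_seq [RHS]big_seq_cond; apply: eq_bigl => a.
  case aZ: (a \in Z) => //=; apply/esym; apply: contraNneq pZ => <-.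
  by rewrite aZ.
pose H z : C := \prod_(0 <= k < j) h k z.
exists r, (fun z => Q z * H z * L j z).
have Lhol : hol (disc p r) (L j).
  apply: hol_limit => e e0.
  have cv : (fun k => 1 * 2^-1 ^+ k) @ \oo --> (1 * 0 : R).
    apply: cvgM; [exact: cvg_cst|apply: cvg_expr].
    by rewrite ger0_norm ?invr_ge0 // invf_lt1 // ltr1n.
  rewrite mulr0 in cv; move/cvgrPdist_le : cv => /(_ e e0)[k0 _ kP].
  exists (T j (maxn j k0)) => z zr; first by apply: hT; apply: Kex_sub (zK z zr).
  apply: le_trans (LP j z (zK z zr) _ (leq_maxl _ _)) _.
  have := kP (maxn j k0) (leq_maxr _ _); rewrite sub0r normrN mul1r => b.
  apply: le_trans b; apply: le_trans (ler_norm _).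
  by have := half (maxn j k0); lra.
split=> //.
  move=> z zr; have zO := Kex_sub (zK z zr).
  apply: holoM (Lhol z zr); apply: holoM.
    rewrite /Q; elim: Z {mZ uZ TZ ZQ Q} => [|a t IH].
      by under eq_fun do rewrite big_nil; exact: holo_cst.
    under eq_fun do rewrite big_cons; case: (a != p) => //.
    apply: holoM IH; apply: holoX; exact: holoB (holo_id _) (holo_cst _ _).
  rewrite /H; elim: (index_iota 0 j) => [|a t IH].
    by under eq_fun do rewrite big_nil; exact: holo_cst.
  by under eq_fun do rewrite big_cons; exact: holoM (hh a z zO) IH.
move=> z zr; have zO := Kex_sub (zK z zr); split; last first.
  by rewrite (FE j z (zK z zr)) TZ ZQ -/(H z) !mulrA.
rewrite !mulf_neq0 //.
- rewrite /Q big_seq_cond prodf_seq_neq0; apply/allP => a _.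
  apply/implyP => /andP[/mZ[_ ma] ap]; rewrite expf_neq0 // subr_eq0.
  apply/eqP => za; apply: ma; rewrite -za; apply: r2m; first by case: (sub z zr).
  by move=> zp; move/eqP: ap; apply; rewrite -za.
- by rewrite /H prodf_seq_neq0; apply/allP => k _ /=; exact: h0.
- have := LP j z (zK z zr) j (leqnn j); rewrite /T big_geq // => b.
  apply/eqP => l0; move: b; rewrite l0 subr0 nc1.
  have : 2^-1 ^+ j <= 1 :> R by rewrite exprn_ile1 // invf_le1 // ler1n.
  lra.
Unshelve. all: by end_near. Qed.

End Weierstrass.

(** * Rank-one projectors *)

Section Projectors.
Variables (R : realType) (n : nat).
Local Notation C := (Cx R).
Local Notation N := (@Normc.normc R).
Implicit Types (P : 'M[R[i]]_n) (w : 'cV[R[i]]_n).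

Lemma adjmxE m k (A : 'M[R[i]]_(m, k)) i j : adjmx A i j = (A j i)^*.
Proof. by rewrite !mxE. Qed.

Lemma mxtrace_adj m k (B : 'M[R[i]]_(m, k)) :
  \tr (B *m adjmx B) = \sum_i \sum_j `|B i j| ^+ 2.
Proof.
apply: eq_bigr => i _; rewrite mxE; apply: eq_bigr => j _.
by rewrite adjmxE sqr_normc.
Qed.

Lemma mxtrace_adj_eq0 m k (B : 'M[R[i]]_(m, k)) :
  \tr (B *m adjmx B) = 0 -> B = 0.
Proof.
rewrite mxtrace_adj => h; apply/matrixP => i j; rewrite mxE.
have /eqP := h; rewrite psumr_eq0 => [/allP/(_ i)|l _]; last first.
  by apply: sumr_ge0 => k0 _; rewrite exprn_ge0.
rewrite mem_index_enum => /(_ isT) /=; rewrite psumr_eq0 => [/allP/(_ j)|l _].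
  by rewrite mem_index_enum => /(_ isT) /=; rewrite sqrf_eq0 normr_eq0 => /eqP.
by rewrite exprn_ge0.
Qed.

Lemma adj_self_neq0 w : w != 0 -> (adjmx w *m w) 0 0 != 0.
Proof.
apply: contra => /eqP h; apply/eqP/mxtrace_adj_eq0.
by rewrite mxtrace_mulC /mxtrace big_ord1.
Qed.

(** An idempotent of trace one has rank one, so its minors vanish. *)
Lemma rank1_minor P i j k l : rank1_projector P -> P i j * P k l = P i l * P k j.
Proof.
move=> [PP _ trP].
have [r [c [d [B [D [CR BC RD]]]]]] : exists (r : nat) (c : 'M[R[i]]_(n, r))
    (d : 'M[R[i]]_(r, n)) (B : 'M[R[i]]_(r, n)) (D : 'M[R[i]]_(n, r)),
    [/\ c *m d = P, B *m c = 1%:M & d *m D = 1%:M].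
  have /row_fullP[B BC] := col_base_full P.
  have /row_freeP[D RD] := row_base_free P.
  by exists (\rank P), (col_base P), (row_base P), B, D; rewrite mulmx_base.
have RC : d *m c = 1%:M.
  have : B *m (P *m P) *m D = B *m P *m D by rewrite PP.
  by rewrite -CR !mulmxA BC mul1mx -!mulmxA RD mulmx1.
have rk : r = 1%N.
  have : \tr P = r%:R by rewrite -CR mxtrace_mulC RC mxtrace1.
  by rewrite trP => /eqP; rewrite eq_sym -[1]/(1%:R) eqr_nat => /eqP.
move: c d CR {B D BC RD RC}; rewrite rk => c d <-.
by rewrite !mxE !big_ord1; ring.
Qed.

Lemma range_minor P w i k l : rank1_projector P -> P *m w = w ->
  w i 0 * P l k = P i k * w l 0.
Proof.
move=> rP Pw; rewrite -[in LHS]Pw -[in RHS]Pw !mxE mulr_suml mulr_sumr.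
apply: eq_bigr => a _.
by rewrite mulrAC (rank1_minor i a l k rP) -mulrA.
Qed.

(** A vector in the line spanned by P is determined by any coordinate on which the
    line does not vanish. *)
Lemma range_eq P w1 w2 j : rank1_projector P -> P *m w1 = w1 -> P *m w2 = w2 ->
  P j j != 0 -> w1 j 0 = w2 j 0 -> w1 = w2.
Proof.
move=> rP P1 P2 Pj e; apply/matrixP => i k; rewrite (ord1 k).
by apply: (mulIf Pj); rewrite (range_minor i j j rP P1) (range_minor i j j rP P2) e.
Qed.

Lemma range_projects P w : rank1_projector P -> P *m w = w -> w != 0 ->
  projects_onto P w.
Proof.
move=> rP Pw w0; have nz := adj_self_neq0 w0; rewrite /projects_onto.
apply/(@scalerI _ _ _ nz); rewrite scalerA divff // scale1r.
apply/matrixP => i k; rewrite mxE [LHS]mulrC [in LHS]mxE mulr_sumr.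
rewrite [RHS]mxE big_ord1 adjmxE.
have -> : (w k 0)^* = \sum_l P l k * (w l 0)^*.
  rewrite -{1}Pw mxE rmorph_sum; apply: eq_bigr => l _; rewrite rmorphM.
  have e : (P k l)^* = P l k 
    by case: rP => _ adjP _; rewrite -[in RHS]adjP adjmxE.
  by congr (_ * _); exact: e.
rewrite mulr_sumr; apply: eq_bigr => l _.
by rewrite adjmxE mulrA (range_minor i k l rP Pw) [X in _ = X]mulrAC mulrA mulrAC.
Qed.

Lemma projects_range P w : projects_onto P w -> w != 0 -> P *m w = w.
Proof.
move=> -> w0; have nz := adj_self_neq0 w0.
rewrite -scalemxAl -mulmxA [X in w *m X]mx11_scalar mul_mx_scalar scalerA.
by rewrite mulVf // scale1r.
Qed.

End Projectors.

(** * Wirtinger derivatives *)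

Section Wirtinger.
Variable R : realType.
Local Notation C := (Cx R).
Local Notation N := (@Normc.normc R).
Local Notation E1 := (@Defs.e1 R).
Local Notation E2 := (@Defs.e2 R).
Implicit Types (f g : R * R -> C) (p q : R * R) (Omega : set (R * R)).

Lemma vder_cderive f p v d : vder f p v d -> cderive v f p = d.
Proof. by case: d => a b [[_ h1] [_ h2]]; rewrite /cderive h1 h2. Qed.

(** Phrased with cderive, so that it carries the values of the derivatives. *)
Definition pdiff f p :=
  vder f p E1 (cderive E1 f p) /\ vder f p E2 (cderive E2 f p).

Lemma pdiffP f p d1 d2 : vder f p E1 d1 -> vder f p E2 d2 -> pdiff f p.
Proof. by move=> h1 h2; split; rewrite (vder_cderive h1, vder_cderive h2). Qed.

Lemma dminusE f p d1 d2 : vder f p E1 d1 -> vder f p E2 d2 ->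
  dminus f p = 2^-1 * (d1 + 'i%C * d2).
Proof. by move=> /vder_cderive h1 /vder_cderive h2; rewrite /dminus h1 h2. Qed.

Lemma dplusE f p d1 d2 : vder f p E1 d1 -> vder f p E2 d2 ->
  dplus f p = 2^-1 * (d1 - 'i%C * d2).
Proof. by move=> /vder_cderive h1 /vder_cderive h2; rewrite /dplus h1 h2. Qed.

Lemma smooth_pdiff Omega f p : smooth_on Omega f -> Omega p -> pdiff f p.
Proof.
move=> sf pO; have [[r _ _] [i _ _]] := sf 1%N.
have [r1 r2] := r p pO; have [i1 i2] := i p pO.
split; split.
- exact (derivableP r1).
- exact (derivableP i1).
- exact (derivableP r2).
- exact (derivableP i2).
Qed.

Lemma pdiffM f g p : pdiff f p -> pdiff g p ->
  pdiff (fun q => f q * g q) p /\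
  dminus (fun q => f q * g q) p = dminus f p * g p + f p * dminus g p.
Proof.
move=> [f1 f2] [g1 g2]; have h1 := vderM f1 g1; have h2 := vderM f2 g2.
split; first exact: pdiffP h1 h2.
by rewrite (dminusE h1 h2) /dminus; ring.
Qed.

Lemma pdiff_sum (I : Type) (s : seq I) (F : I -> R * R -> C) p :
  (forall i, pdiff (F i) p) ->
  pdiff (fun q => \sum_(i <- s) F i q) p /\
  dminus (fun q => \sum_(i <- s) F i q) p = \sum_(i <- s) dminus (F i) p.
Proof.
move=> dF; elim: s => [|i s [[s1 s2] e]].
  under eq_fun do rewrite big_nil.
  have h1 := @vder_cst R _ 0 p E1; have h2 := @vder_cst R _ 0 p E2.
  by split; [exact: pdiffP h1 h2|rewrite big_nil (dminusE h1 h2) mulr0 addr0 mulr0].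
under eq_fun do rewrite big_cons.
have [f1 f2] := dF i; have h1 := vderD f1 s1; have h2 := vderD f2 s2.
split; first exact: pdiffP h1 h2.
by rewrite (dminusE h1 h2) big_cons -e /dminus; ring.
Qed.

Lemma pdiff_near f g p : pdiff f p -> (\forall q \near p, f q = g q) ->
  pdiff g p /\ dminus g p = dminus f p.
Proof.
move=> [f1 f2] e; have h1 := vder_near f1 e; have h2 := vder_near f2 e.
split; first exact: pdiffP h1 h2.
by rewrite (dminusE h1 h2).
Qed.

Lemma dplus_near f g p : pdiff f p -> (\forall q \near p, f q = g q) ->
  dplus g p = dplus f p.
Proof.
move=> [f1 f2] e; have h1 := vder_near f1 e; have h2 := vder_near f2 e.
by rewrite (dplusE h1 h2).
Qed.

Lemma conjiM (z : C) : ('i%C * z)^* = - ('i%C * z^*).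
Proof.
case: z => a b; apply/eqP; rewrite eq_complex /= !(mul0r, mul1r, sub0r, add0r).
by rewrite !opprK !eqxx.
Qed.

Lemma pdiff_conj f p : pdiff f p ->
  pdiff (fun q => (f q)^*) p /\ dplus (fun q => (f q)^*) p = (dminus f p)^*.
Proof.
move=> [f1 f2].
have cj v d : vder f p v d -> vder (fun q => (f q)^*) p v d^*.
  move=> [h1 h2]; split.
    rewrite (_ : (fun q => _) = (fun q => complex.Re (f q))).
      by case: d h1 {h2}.
    by apply/funext => q; case: (f q).
  rewrite (_ : (fun q => _) = - (fun q => complex.Im (f q))).
    have := is_deriveN h2; case: (d) => a b; exact.
  by apply/funext => q; rewrite /GRing.opp /=; case: (f q).
have h1 := cj _ _ f1; have h2 := cj _ _ f2.
split; first exact: pdiffP h1 h2.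
rewrite (dplusE h1 h2) /dminus rmorphM rmorphD fmorphV rmorph_nat.
by congr (_ * (_ + _)); rewrite -[RHS]/(('i%C * cderive E2 f p)^*) conjiM.
Qed.

Lemma dminus_mxM m k l (F : R * R -> 'M[R[i]]_(m, k)) (G : R * R -> 'M[R[i]]_(k, l)) p :
  (forall i j, pdiff (fun q => F q i j) p) ->
  (forall i j, pdiff (fun q => G q i j) p) ->
  dminus_mx (fun q => F q *m G q) p = dminus_mx F p *m G p + F p *m dminus_mx G p.
Proof.
move=> dF dG; apply/matrixP => i j; rewrite !mxE.
under [in LHS]eq_fun do rewrite mxE.
have H a := pdiffM (dF i a) (dG a j).
have [_ ->] := pdiff_sum (index_enum _) (fun a => (H a).1).
rewrite -big_split; apply: eq_bigr => a _ /=.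
by rewrite (H a).2 !mxE.
Qed.

Lemma dminus_mx_near m k (F G : R * R -> 'M[R[i]]_(m, k)) p :
  (forall i j, pdiff (fun q => F q i j) p) -> (\forall q \near p, F q = G q) ->
  dminus_mx G p = dminus_mx F p.
Proof.
move=> dF e; apply/matrixP => i j; rewrite !mxE.
by apply: (pdiff_near (dF i j) _).2; apply: filterS e => q ->.
Qed.

End Wirtinger.

(** * Smoothness of holomorphic functions *)

Section Smoothness.
Variable R : realType.
Local Notation C := (Cx R).
Local Notation N := (@Normc.normc R).
Local Notation E1 := (@Defs.e1 R).
Local Notation E2 := (@Defs.e2 R).
Variable Omega : set (R * R).
Hypothesis oO : open Omega.

Lemma near_open p : Omega p -> \forall q \near p, Omega q.
Proof. by move=> pO; exact: open_nbhs_nbhs. Qed.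

Lemma Ck_ext k (f g : R * R -> R) : (forall p, Omega p -> f p = g p) ->
  Ck k Omega f -> Ck k Omega g.
Proof.
elim: k f g => [|k IH] f g fg.
  move=> cf p pO A; rewrite /= -(fg p pO) => /(cf p pO).
  by apply: filterS2 (near_open pO) => q qO /=; rewrite (fg q qO).
move=> [df d1 d2].
have nfg p : Omega p -> {near p, f =1 g}.
  by move=> /near_open; apply: filterS => q; exact: fg.
have D v p : Omega p -> 'D_v f p = 'D_v g p.
  by move=> pO; exact: near_eq_derive (nfg p pO).
split.
- move=> p pO; have [h1 h2] := df p pO.
  by split; [apply: near_eq_derivable h1|apply: near_eq_derivable h2]; exact: nfg.
- by apply: IH d1 => p; exact: D.
- by apply: IH d2 => p; exact: D.
Qed.

(** The domain Omega in the complex coordinate. *)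
Definition Oc : set C := [set z | Omega (ofC z)].

Lemma Oc_open z : Oc z -> exists2 r : R, 0 < r & disc z r `<=` Oc.
Proof.
move=> /near_open /(@continuous_ofC R z) /nbhsC[r r0 h].
by exists r => // w; exact: h.
Qed.

Lemma Oc_near z : Oc z -> \forall w \near z, Oc w.
Proof. by move=> /Oc_open[r r0 h]; apply/nbhsC; exists r. Qed.

Lemma hol_cD f : hol Oc f -> hol Oc (cD f).
Proof.
by move=> hf z /Oc_near zO; apply: holo_cD; apply: filterS zO => w; exact: hf.
Qed.

(** The partial derivatives of f are f' and i f', which are again holomorphic, so
    the induction over the order of differentiability is over all f. *)
Lemma hol_smooth (f : C -> C) : hol Oc f -> smooth_on Omega (fun p => f (toC p)).
Proof.
move=> + k; elim: k f => [|k IH] f hf.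
  have cf p : Omega p -> ccont f (toC p).
    by move=> pO; apply: holo_cont; apply: hf; rewrite /Oc /= toCK.
  split=> p pO A.
    by move=> /continuousRe /(ccontP (cf p pO)) /nbhs_toC.
  by move=> /continuousIm /(ccontP (cf p pO)) /nbhs_toC.
have d p : Omega p -> vder (fun q => f (toC q)) p E1 (cD f (toC p)) /\
    vder (fun q => f (toC q)) p E2 ('i%C * cD f (toC p)).
  move=> pO; have h : cder f (toC p) (cD f (toC p)).
    by apply: holo_cDP; apply: hf; rewrite /Oc /= toCK.
  by split; [exact: vder_holo1|exact: vder_holo2].
have hd := hol_cD hf.
have hid : hol Oc (fun z => 'i%C * cD f z).
  by move=> z zO; apply: holoM (holo_cst _ _) (hd z zO).
have [r1 i1] := IH _ hd; have [r2 i2] := IH _ hid.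
split; split.
- move=> p /d[[[h1 _] _] [[h2 _] _]]; exact (conj h1 h2).
- apply: Ck_ext r1 => p /d[[[_ h1] _] _]; exact (esym h1).
- apply: Ck_ext r2 => p /d[_ [[_ h1] _]]; exact (esym h1).
- move=> p /d[[_ [h1 _]] [_ [h2 _]]]; exact (conj h1 h2).
- apply: Ck_ext i1 => p /d[[_ [_ h1]] _]; exact (esym h1).
- apply: Ck_ext i2 => p /d[_ [_ [_ h1]]]; exact (esym h1).
Qed.

Lemma dminus_hol (f : C -> C) p : holo_at f (toC p) ->
  dminus (fun q => f (toC q)) p = 0.
Proof.
move=> /holo_cder[l h]; rewrite (dminusE (vder_holo1 h) (vder_holo2 h)).
by rewrite mulrA -expr2 sqr_i mulN1r subrr mulr0.
Qed.

Lemma smooth_ccont (f : R * R -> C) z : smooth_on Omega f -> Oc z ->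
  ccont (fun z => f (ofC z)) z.
Proof.
move=> /(_ 0%N)[cr ci] zO; split; apply: cvgC_ReIm.
  by move=> A /(cr _ zO) /continuous_ofC.
by move=> A /(ci _ zO) /continuous_ofC.
Qed.

Lemma smooth_ccont_d1 (f : R * R -> C) z : smooth_on Omega f -> Oc z ->
  ccont (fun z => cderive E1 f (ofC z)) z.
Proof.
move=> /(_ 1%N)[[_ cr _] [_ ci _]] zO; split; apply: cvgC_ReIm.
  by move=> A /(cr _ zO) /continuous_ofC.
by move=> A /(ci _ zO) /continuous_ofC.
Qed.

End Smoothness.

(** * Holomorphic projector-valued functions *)

Section Main.
Variables (R : realType) (n : nat) (Omega : set (R * R)).
Variable X : R * R -> 'M[R[i]]_n.
Local Notation C := (Cx R).
Local Notation N := (@Normc.normc R).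
Local Notation E1 := (@Defs.e1 R).
Local Notation E2 := (@Defs.e2 R).
Hypothesis oO : open Omega.
Hypothesis sX : smooth_mx_on Omega X.
Hypothesis pX : forall p, Omega p -> rank1_projector (X p).
Implicit Types (p q : R * R) (z w : C) (i j k : 'I_n).

Lemma X_pdiff p i j : Omega p -> pdiff (fun q => X q i j) p.
Proof. by move=> pO; exact: smooth_pdiff (sX i j) pO. Qed.

Lemma X_adj p i j : Omega p -> (X p j i)^* = X p i j.
Proof. by move=> /pX[_ aX _]; rewrite -[in RHS]aX adjmxE. Qed.

Lemma dplusX p : Omega p -> dplus_mx X p = adjmx (dminus_mx X p).
Proof.
move=> pO; apply/matrixP => i j; rewrite adjmxE !mxE.
have [d <-] := pdiff_conj (X_pdiff j i pO).
apply: dplus_near d _; apply: filterS (near_open oO pO) => q qO.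
exact: X_adj.
Qed.

(** With B the product of the derivative and X, the matrix defining the lowering
    operator is B times its adjoint, so it vanishes exactly when B does. *)
Lemma Pi_minus_eq0 p : Omega p ->
  Pi_minus X p = 0 <-> dminus_mx X p *m X p = 0.
Proof.
move=> pO; have [XX aX _] := pX pO; set B := dminus_mx X p *m X p.
have adjM : X p *m dplus_mx X p = adjmx B.
  rewrite dplusX // -{1}aX /B; apply/matrixP => i j; rewrite adjmxE !mxE.
  rewrite rmorph_sum; apply: eq_bigr => k _; rewrite rmorphM mulrC.
  by rewrite !adjmxE.
have AE : dminus_mx X p *m X p *m dplus_mx X p = B *m adjmx B.
  by rewrite -{1}XX mulmxA -mulmxA adjM.
rewrite /Pi_minus AE; split=> [|->]; last by rewrite mul0mx eqxx.
case: (eqVneq (B *m adjmx B) 0) => [e _|nA /eqP].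
  by apply: mxtrace_adj_eq0; rewrite e mxtrace0.
rewrite scaler_eq0 (negbTE nA) orbF invr_eq0 => /eqP trA.
exact: mxtrace_adj_eq0.
Qed.

(** Differentiating X y = y for the holomorphic field y = c x shows that the
    derivative of X annihilates y, hence also X. *)
Lemma holomorphic_Pi_minus : holomorphic Omega X ->
  forall p, Omega p -> Pi_minus X p = 0.
Proof.
move=> [x [c [sx sc xP c0 dy]]] p pO; apply/(Pi_minus_eq0 pO).
pose y q := c q *: x q.
have dy0 i (j : 'I_1) : pdiff (fun q => y q i j) p.
  apply: (pdiff_near (pdiffM (smooth_pdiff sc pO) (smooth_pdiff (sx i j) pO)).1 _).1.
  by near=> q; rewrite mxE.
have Xy q : Omega q -> X q *m y q = y q.
  by move=> qO; have [x0 xq] := xP q qO; rewrite -scalemxAr (projects_range xq).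
have := dminus_mxM (fun i j => X_pdiff i j pO) dy0.
have dXy i (j : 'I_1) : pdiff (fun q => (X q *m y q) i j) p.
  apply: (pdiff_near (dy0 i j) _).1.
  by apply: filterS (near_open oO pO) => q qO; rewrite Xy.
rewrite -(dminus_mx_near dXy (G := y)); last first.
  by apply: filterS (near_open oO pO) => q; exact: Xy.
rewrite (dy p pO) mulmx0 addr0 => /esym.
rewrite -scalemxAr => /eqP; rewrite scaler_eq0 (negbTE (c0 p pO)) /= => /eqP dx.
have [_ ->] := xP p pO.
by rewrite -scalemxAr mulmxA dx mul0mx scaler0.
Unshelve. all: by end_near. Qed.

Section Converse.
Hypothesis X0 : forall p, Omega p -> Pi_minus X p = 0.
Local Notation O := (Oc Omega).
Local Notation Xc := (fun z => X (ofC z)).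

(** Differentiation of X X = X, where one of the two terms vanishes by
    hypothesis. *)
Lemma dminus_range p : Omega p -> X p *m dminus_mx X p = dminus_mx X p.
Proof.
move=> pO; have dX i j := X_pdiff i j pO.
have := dminus_mxM dX dX; rewrite (proj1 (Pi_minus_eq0 pO) (X0 pO)) add0r => <-.
have dXX i j : pdiff (fun q => (X q *m X q) i j) p.
  apply: (pdiff_near (dX i j) _).1.
  by apply: filterS (near_open oO pO) => q /pX[-> _ _].
by apply/esym/(dminus_mx_near dXX); apply: filterS (near_open oO pO) => q /pX[-> _ _].
Qed.

(** The derivative of the column X e_j lies in the line spanned by X e_j, so it is
    proportional to this column; the quotient rule then gives zero for the
    derivative of X e_j divided by its j-th coordinate. *)
Lemma section_holo z i j : O z -> Xc z j j != 0 ->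
  holo_at (fun z => Xc z i j / Xc z j j) z.
Proof.
move=> zO zj.
have cX k l w : O w -> ccont (fun w => Xc w k l) w.
  by move=> wO; exact: smooth_ccont (sX k l) wO.
have cdX k l w : O w -> ccont (fun w => cderive E1 (fun q => X q k l) (ofC w)) w.
  by move=> wO; exact: smooth_ccont_d1 (sX k l) wO.
pose d (v p : R * R) : C :=
  cderive v (fun q => X q i j) p * (X p j j)^-1 +
  X p i j * (- cderive v (fun q => X q j j) p / X p j j ^+ 2).
have good : \forall w \near z, O w /\ Xc w j j != 0.
  by apply: filterS2 (Oc_near oO zO) (cont_neq0 (cX j j z zO) zj).
have dE v p : X p j j != 0 -> vder (fun q => X q i j) p v (cderive v (fun q => X q i j) p) ->
    vder (fun q => X q j j) p v (cderive v (fun q => X q j j) p) ->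
    vder (fun q => X q i j / X q j j) p v (d v p).
  move=> pj h1 h2; apply: vderM h1 _.
  have := vder_comp h2 (cderV (f := id) pj (cder_id _)).
  rewrite (_ : - 1 / _ * _ = - cderive v (fun q => X q j j) p / X p j j ^+ 2) //.
  by field.
have CR p : Omega p -> X p j j != 0 -> d E2 p = 'i%C * d E1 p.
  move=> pO pj.
  have [a1 a2] := X_pdiff i j pO; have [b1 b2] := X_pdiff j j pO.
  have e : dminus (fun q => X q i j) p * X p j j =
      X p i j * dminus (fun q => X q j j) p.
    have rg : X p *m col j (dminus_mx X p) = col j (dminus_mx X p).
      by rewrite !colE mulmxA dminus_range.
    have := range_minor i j j (pX pO) rg.
    by rewrite !mxE.
  move: e; rewrite /dminus /d -[(0 +i* 1)]/'i%C.
  set A1 := cderive E1 _ p; set A2 := cderive E2 _ p.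
  set B1 := cderive E1 (fun q => X q j j) p.
  set B2 := cderive E2 (fun q => X q j j) p.
  set x := X p i j; set y := X p j j => e.
  have ii : 'i%C * 'i%C = -1 :> C by rewrite -expr2 sqr_i.
  have e' : (A1 + 'i%C * A2) * y = x * (B1 + 'i%C * B2).
    have two : (2^-1 : C) != 0 by rewrite invr_eq0 pnatr_eq0.
    by apply: (mulfI two); rewrite mulrA e; ring.
  have h : A2 / y + x * (- B2 / y ^+ 2) -
      'i%C * (A1 / y + x * (- B1 / y ^+ 2)) =
      - 'i%C / y ^+ 2 * ((A1 + 'i%C * A2) * y - x * (B1 + 'i%C * B2)) +
      (1 + 'i%C * 'i%C) * (A2 / y - x * B2 / y ^+ 2).
    by field.
  by apply/eqP; rewrite -subr_eq0 h e' subrr mulr0 ii subrr mul0r addr0.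
have hl : holo_at (fun w => Xc w i j / Xc w j j) (toC (ofC z)).
  apply: (@holo_CR R _ (fun w => d E1 (ofC w))).
    have : nbhs (toC (ofC z)) [set w | O w /\ Xc w j j != 0] by rewrite ofCK.
    move=> /nbhs_toC; apply: filterS => q; rewrite /= /Oc /= toCK => -[qO qj].
    have [a1 a2] := X_pdiff i j qO; have [b1 b2] := X_pdiff j j qO.
    have -> : (fun q0 => X (ofC (toC q0)) i j / X (ofC (toC q0)) j j) =
        (fun q0 => X q0 i j / X q0 j j).
      by apply/funext => q0; rewrite toCK.
    by split; [exact: dE|rewrite -CR //; exact: dE].
  have : nbhs (toC (ofC z)) [set w | O w /\ Xc w j j != 0] by rewrite ofCK.
  move=> /nbhs_toC; apply: filterS => q /= [qO qj].
  rewrite /d; apply: contD.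
    by apply: contM (cdX _ _ _ qO) (contV qj (cX _ _ _ qO)).
  apply: contM (cX _ _ _ qO) _; apply: contM.
    apply: cont_near (contM (cont_cst (-1) _) (cdX j j _ qO)) _.
    by near=> w; rewrite mulN1r.
  under eq_fun do rewrite expr2.
  apply: contV; first by rewrite mulf_neq0.
  by apply: contM; exact: cX.
by rewrite ofCK in hl.
Unshelve. all: by end_near. Qed.

(** A holomorphic section s of the line bundle around z. The normalization of its
    j-th coordinate makes m the order of the pole at z of the meromorphic
    section with j-th coordinate 1. *)
Definition local_section z j (m : nat) (r : R) (s : 'I_n -> C -> C) :=
  [/\ 0 < r, disc z r `<=` O, forall i, hol (disc z r) (s i),
    forall w, disc z r w -> w <> z -> Xc w j j != 0 &
    forall w, disc z r w -> [/\ s j w = (w - z) ^+ m,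
      Xc w *m (\col_i s i w) = \col_i s i w & \col_i s i w != 0]].

Lemma X_diag_neq0 p : Omega p -> exists k, X p k k != 0.
Proof.
move=> /pX[_ _ trX]; apply: contrapT => nk.
have := oner_neq0 R[i]; rewrite -trX /mxtrace big1 ?eqxx // => k _.
by apply/eqP; apply: contrapT => /negP kk; apply: nk; exists k.
Qed.

(** The section normalized by a coordinate k that is nonzero at z is holomorphic
    near z. Its j-th coordinate is (w - z)^m u w with u without zeros, unless
    it vanishes identically near z, and it remains to divide by u. *)
Lemma exists_local_section z j : O z -> ~ (\forall w \near z, Xc w j j = 0) ->
  exists m r s, local_section z j m r s.
Proof.
move=> zO nzj; have [k zk] := X_diag_neq0 zO.
have cX w : O w -> ccont (fun w => Xc w k k) w.
  by move=> wO; exact: smooth_ccont (sX k k) wO.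
have [r r0 rP] : exists2 r : R, 0 < r & forall w, disc z r w -> O w /\ Xc w k k != 0.
  have : \forall w \near z, O w /\ Xc w k k != 0.
    by apply: filterS2 (Oc_near oO zO) (cont_neq0 (cX z zO) zk) => w.
  by move=> /nbhsC[r r0 rP]; exists r.
pose t i w : C := Xc w i k / Xc w k k.
have ht i : hol (disc z r) (t i).
  by move=> w /rP[wO wk]; exact: section_holo.
have mn w : O w -> Xc w j j * Xc w k k = Xc w j k * (Xc w j k)^*.
  move=> wO; rewrite (rank1_minor j j k k (pX wO)); congr (_ * _).
  exact (esym (X_adj k j wO)).
have [[s s0 ts]|[m [s [u [s0 hu tu]]]]] := holo_factor r0 (ht j).
  case: nzj; apply/nbhsC; exists (Num.min r s); first by rewrite lt_min r0.
  move=> w; rewrite lt_min => /andP[wr ws].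
  have [wO wk] := rP w wr; have /eqP := ts w ws.
  rewrite /t mulf_eq0 invr_eq0 (negbTE wk) orbF => /eqP jk.
  have := mn w wO; rewrite jk mul0r => /eqP.
  by rewrite mulf_eq0 (negbTE wk) orbF => /eqP.
pose r1 := Num.min r s.
have sub w : disc z r1 w -> disc z r w /\ disc z s w.
  by rewrite /disc /= lt_min => /andP.
exists m, r1, (fun i w => t i w / u w); split.
- by rewrite lt_min r0.
- by move=> w /sub[/rP[]].
- move=> i w /sub[wr ws]; apply: holoM (ht i w wr) _.
  by apply: holoV (hu w ws); case: (tu w ws).
- move=> w /sub[wr ws] wz; have [wO wk] := rP w wr; have [u0 te] := tu w ws.
  have jk : Xc w j k != 0.
    have : t j w != 0 by rewrite te mulf_neq0 // expf_neq0 // subr_eq0; apply/eqP.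
    by rewrite /t mulf_eq0 negb_or => /andP[].
  have : Xc w j j * Xc w k k != 0 by rewrite mn // mulf_neq0 // conjc_eq0.
  by rewrite mulf_eq0 negb_or => /andP[].
move=> w /sub[wr ws]; have [wO wk] := rP w wr; have [u0 te] := tu w ws.
have sE : \col_i (t i w / u w) = (Xc w k k * u w)^-1 *: col k (Xc w).
  by apply/matrixP => i l; rewrite !mxE /t; field; rewrite u0 wk.
split; first by rewrite te mulfK.
  rewrite sE -scalemxAr; congr (_ *: _).
  by rewrite colE mulmxA; case: (pX wO) => ->.
rewrite sE scaler_eq0 invr_eq0 mulf_eq0 (negbTE wk) (negbTE u0) /=.
by apply: contraNneq wk => /matrixP/(_ k 0); rewrite !mxE => ->.
Qed.

(** The least index j for which the section with j-th coordinate 1 is meromorphic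
    near z. Being locally constant, it selects one such index on each connected
    component. *)
Definition leading z j := ~ (\forall w \near z, Xc w j j = 0) /\
  forall i, (i < j)%N -> \forall w \near z, Xc w i i = 0.

Lemma leading_unique z j k : leading z j -> leading z k -> j = k.
Proof.
move=> [j1 j2] [k1 k2]; case: (ltngtP j k) => [jk|kj|/val_inj //].
- by case: j1; exact (k2 j jk).
- by case: k1; exact (j2 k kj).
Qed.

Lemma exists_leading z : O z -> exists j, leading z j.
Proof.
move=> zO; have [k zk] := X_diag_neq0 zO.
pose P (i : nat) := `[< exists2 j : 'I_n, val j = i & ~ (\forall w \near z, Xc w j j = 0) >].
have exP : exists a : nat, P a.
  exists k; apply/asboolP; exists k => // /nbhs_singleton e.
  by move/eqP: zk; apply.
have [i /asboolP[j <- nj] jmin] := ex_minnP exP.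
exists j; split=> // l lj; apply: contrapT => nl.
have : P l by apply/asboolP; exists l.
by move=> /jmin; rewrite leqNgt lj.
Qed.

(** A diagonal entry that is not identically zero near z is nonzero on a punctured
    disc, hence not identically zero near any point of the disc. *)
Lemma leading_near z j : O z -> leading z j -> \forall w \near z, leading w j.
Proof.
move=> zO [nj lj].
have [m [r [s [r0 rO _ rX _]]]] := exists_local_section zO nj.
have h1 i : \forall w \near z, (i < j)%N -> \forall v \near w, Xc v i i = 0.
  have [ij|_] := boolP (i < j)%N; last by near=> w.
  by have /near_join := lj i ij; apply: filterS => w h _.
have {}h1 := filter_forall (nbhsC_filter z) h1.
apply: filterS2 h1 (disc_nbhs (disc_center z r0)) => w h wr.
split=> [hw|i ij]; last exact (h i ij).
have [wz|/eqP wz] := eqVneq w z; first by apply: nj; rewrite -wz.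
by have := rX w wr wz; rewrite (nbhs_singleton hw) eqxx.
Unshelve. all: by end_near. Qed.

(** The section with leading coordinate 1 is meromorphic on the whole domain, with a
    pole of order m z at z. Multiplication by a holomorphic function F that
    vanishes to the order m z at every z gives a section y without zeros and
    poles. At each point, y is built from the local section there and the
    local factorization of F; its leading coordinate is F, which shows that
    nearby choices define the same section. *)
Lemma Pi_minus_holomorphic : holomorphic Omega X.
Proof.
have ord z : exists m, O z -> exists j r s, leading z j /\ local_section z j m r s.
  have [zO|nz] := pselect (O z); last by exists 0%N.
  have [j lj] := exists_leading zO.
  have [m [r [s ls]]] := exists_local_section zO lj.1.
  by exists m => _; exists j, r, s.
have [m mP] := choice ord.
have vec0 z j (a : 'cV[R[i]]_n) : O z -> Xc z j j != 0 -> Xc z *m a = a ->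
    a != 0 -> a j 0 != 0.
  move=> zO zj Xa; apply: contra_neq => aj.
  by apply: (range_eq (pX zO) Xa (mulmx0 _ _) zj); rewrite aj mxE.
have m0 (p : C) : O p -> exists2 r : R, 0 < r &
    forall z, disc p r z -> z <> p -> m z = 0%N.
  move=> pO; have [j [r [s [lp [r0 rO _ rX _]]]]] := mP p pO.
  have /nbhsC[r1 r10 lr1] := leading_near pO lp.
  exists (Num.min r r1); first by rewrite lt_min r0.
  move=> z; rewrite /disc /= lt_min => /andP[zr zr1] zp.
  have zO : O z := rO z zr.
  have [j' [r' [s' [lz [r'0 _ _ _ ls]]]]] := mP z zO.
  have [sj Xs sn] := ls z (disc_center z r'0).
  have zj := rX z zr zp; rewrite (leading_unique (lr1 z zr1) lz) in zj.
  have := vec0 _ _ _ zO zj Xs sn; rewrite mxE sj subrr expr0n.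
  by case: (m z) => //=; rewrite eqxx.
have [F FP] := weierstrass (Oc_open oO) m0.
have sec z : exists y : 'cV[R[i]]_n, O z -> exists j r s (v : C -> C),
    [/\ leading z j, local_section z j (m z) r s, hol (disc z r) v,
      forall w, disc z r w -> v w != 0 /\ F w = (w - z) ^+ m z * v w
    & y = v z *: \col_i s i z].
  have [zO|nz] := pselect (O z); last by exists 0.
  have [j [r [s [lz [r0 rO hs rX ls]]]]] := mP z zO.
  have [r' [v [r'0 hv vF]]] := FP z zO.
  exists (v z *: \col_i s i z) => _.
  have sub w : disc z (Num.min r r') w -> disc z r w /\ disc z r' w.
    by rewrite /disc /= lt_min => /andP.
  exists j, (Num.min r r'), s, v; split=> //.
  - split; first by rewrite lt_min r0.
    + by move=> w /sub[/rO].
    + by move=> i w /sub[wr _]; exact: hs.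
    + by move=> w /sub[wr _]; exact: rX.
    + by move=> w /sub[wr _]; exact: ls.
  - by move=> w /sub[_]; exact: hv.
  - by move=> w /sub[_]; exact: vF.
have [y yP] := choice sec.
have yX z : O z -> [/\ Xc z *m y z = y z, y z != 0 &
    forall j, leading z j -> y z j 0 = F z].
  move=> zO; have [j [r [s [v [lz [r0 _ _ _ ls] _ vF ->]]]]] := yP z zO.
  have [sj Xs sn] := ls z (disc_center z r0).
  have [v0 Fz] := vF z (disc_center z r0).
  split=> [||k lk]; first by rewrite -scalemxAr Xs.
    by rewrite scaler_eq0 negb_or v0.
  by rewrite (leading_unique lk lz) !mxE sj Fz mulrC.
have hy i : hol O (fun z => y z i 0).
  move=> z zO; have [j [r [s [v [lz [r0 rO hs rX ls] hv vF yz]]]]] := yP z zO.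
  have zr := disc_center z r0.
  apply: holo_near (holoM (hv z zr) (hs i z zr)) _.
  apply: filterS2 (leading_near zO lz) (disc_nbhs zr) => w lw wr.
  suff -> : y w = v w *: \col_i s i w by rewrite !mxE.
  have [-> //|/eqP wz] := eqVneq w z.
  have wO : O w := rO w wr.
  have [Xy _ yj] := yX w wO; have [sj Xs _] := ls w wr.
  apply: (range_eq (pX wO) Xy _ (rX w wr wz)); first by rewrite -scalemxAr Xs.
  by rewrite (yj j lw) !mxE sj mulrC; case: (vF w wr).
have Ot q : Omega q -> O (toC q) by rewrite /Oc /= toCK.
exists (fun q => y (toC q)), (fun=> 1); split.
- move=> i j; rewrite (ord1 j); exact: (hol_smooth oO (hy i)).
- apply: (hol_smooth oO (f := fun=> 1)) => z _; exact: holo_cst.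
- move=> q qO; have [Xy y0 _] := yX (toC q) (Ot q qO); split=> //.
  by apply: range_projects (pX qO) _ y0; rewrite toCK in Xy.
- by move=> q _; exact: oner_neq0.
move=> q qO; apply/matrixP => i j; rewrite !mxE (ord1 j).
under eq_fun do rewrite scale1r.
exact: (dminus_hol (hy i (toC q) (Ot q qO))).
Qed.

End Converse.
End Main.

Local Close Scope complex_scope.
Unset Implicit Arguments.

Theorem mainTheorem11 (R : realType) (N : nat) (Omega : set (R * R))
    (X : R * R -> 'M[R[i]]_N)
    (hOmega : open Omega)
    (hsmooth : smooth_mx_on Omega X)
    (hproj : forall p, Omega p -> rank1_projector (X p)) :
  holomorphic Omega X <-> (forall p, Omega p -> Pi_minus X p = 0).
Proof.
split; first exact: holomorphic_Pi_minus hOmega hsmooth hproj.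
exact: Pi_minus_holomorphic hOmega hsmooth hproj.
Qed.
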